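(* Let $\{A_0=I_{n-1}, A_1, A_2={}^tA_1\}$ be a non-symmetric association scheme of rank $3$ and order $n-1$, put $a=n-1$, and let $\mathcal{D}=\{\sigma_h\mid h\in H\}\cup\{\mu_g\mid g\in G\setminus H\}$ be the association scheme of order $4n$ constructed from it in the context. Then $\mathcal{D}$ has exactly five irreducible characters $\chi_1,\dots,\chi_5$, and its character table, with the multiplicities $m_{\chi_i}$ in the last column, is $$\begin{array}{c|rrrrrrrr|c} &\sigma_1&\sigma_{x^2}&\sigma_y&\sigma_{x^2y}&\mu_x&\mu_{x^3}&\mu_{xy}&\mu_{x^3y}&m_{\chi_i}\\ \hline \chi_1&1&1&1&1&a&a&a&a&1\\ \chi_2&1&1&-1&-1&a&a&-a&-a&1\\ \chi_3&1&1&1&1&-1&-1&-1&-1&a\\ \chi_4&1&1&-1&-1&-1&-1&1&1&a\\ \chi_5&2&-2&0&0&0&0&0&0&n \end{array}$$ The Frobenius-Schur indicators are $\nu(\chi_i)=1$ for $i=1,2,3,4,5$.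
   Context: ${}^tM$ is the transpose of $M$, $I_N$ the $N\times N$ identity matrix, $J_N$ the $N\times N$ all-ones matrix, $\otimes$ the Kronecker product. Association scheme: a set $\mathcal{S}=\{S_0,\dots,S_d\}$ of $d+1$ non-zero $N\times N$ matrices with entries in $\{0,1\}$ is an association scheme of order $N$ and rank $d+1$ if (1) $S_0=I_N$; (2) $\sum_{i=0}^d S_i=J_N$; (3) for all $0\le i,j\le d$, ${}^tS_i$ and $S_iS_j$ are linear combinations of $S_0,\dots,S_d$. It is symmetric if ${}^tS_i=S_i$ for all $i$, and non-symmetric otherwise. All rows of $S_i$ contain the same number of ones, called the valency $n_i$ of $S_i$. Characters: $\mathbb{C}\mathcal{S}=\bigoplus_i\mathbb{C}S_i$ is the adjacency algebra over $\mathbb{C}$; it is a semisimple subalgebra of the $N\times N$ complex matrices. $\mathrm{Irr}(\mathcal{S})$ is the set of irreducible characters of $\mathbb{C}\mathcal{S}$ (traces of irreducible representations), and the character table is the matrix $(\chi(S_j))_{\chi\in\mathrm{Irr}(\mathcal{S}),\,0\le j\le d}$. The standard representation is $S_i\mapsto S_i$; writing its character as $\sum_{\chi\in\mathrm{Irr}(\mathcal{S})}m_\chi\chi$, the coefficient $m_\chi$ is the multiplicity of $\chi$. The Frobenius-Schur indicator of $\chi\in\mathrm{Irr}(\mathcal{S})$ is $$\nu(\chi)=\frac{m_\chi}{N\chi(S_0)}\sum_{i=0}^d\frac{1}{n_i}\chi(S_i^2).$$ Group: let $x,y$ be the permutation matrices $$x=\begin{pmatrix}0&1&0&0\\0&0&1&0\\0&0&0&1\\1&0&0&0\end{pmatrix},\quad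 y=\begin{pmatrix}0&1&0&0\\1&0&0&0\\0&0&0&1\\0&0&1&0\end{pmatrix}$$ and $G=\langle x,y\rangle\cong D_8$ the group of order $8$ generated by them under matrix multiplication; its identity is $1=I_4$. Let $H=C_G(y)=\{1,x^2,y,x^2y\}$, so $G\setminus H=\{x,x^3,xy,x^3y\}$. Construction of $\mathcal{D}$: given the scheme $\{A_0,A_1,A_2\}$ of order $n-1$ (it is known that then $n\equiv 0\pmod 4$), define $n\times n$ block matrices (blocks of sizes $1$ and $n-1$; $\mathbf{1}$ is the all-ones row vector of length $n-1$) $$E=\begin{pmatrix}0&\mathbf{1}\\ {}^t\mathbf{1}&O\end{pmatrix},\qquad \tilde{A}_i=\begin{pmatrix}0&0\\0&A_i\end{pmatrix}\ (i=1,2).$$ Define $4n\times 4n$ matrices $\sigma_h=I_n\otimes h$ for $h\in H$ and $\mu_g=E\otimes g+\tilde{A}_1\otimes gy+\tilde{A}_2\otimes gx^2y$ for $g\in G\setminus H$. The set $\mathcal{D}$ of these $8$ matrices is an association scheme of order $4n$ with identity element $\sigma_1$. *)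

(* Defs.v *)
From HB Require Import structures.
From mathcomp Require Import all_boot all_order all_algebra all_fingroup.
From mathcomp Require Import mxtens complex reals.

Set Implicit Arguments.
Unset Strict Implicit.
Unset Printing Implicit Defensive.

Import GRing.Theory.
Local Open Scope ring_scope.

Section Schemes.
Variables (F : fieldType) (N : nat).
Implicit Types (S : seq 'M[F]_N) (M : 'M[F]_N).

(* A finite set of matrices is a duplicate-free sequence; the order of the    *)
(* elements is irrelevant, and S_0 is recovered as the identity matrix.       *)
Definition assoc_scheme S : Prop :=
  [/\ uniq S,
      {in S, forall M, M != 0 /\ forall i j, M i j \in [:: 0; 1]},
      1%:M \in S /\ \sum_(M <- S) M = const_mx 1,
      {in S, forall M, M^T \in <<S>>%VS}
    & {in S &, forall M P, M *m P \in <<S>>%VS}].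

Definition symmetric_scheme S : Prop := {in S, forall M, M^T = M}.

(* The number of ones in some row of M: in an association scheme, where this  *)
(* is used, all rows contain the same number of ones.                         *)
Definition valency M : nat :=
  if [pick i : 'I_N] is Some i then #|[set j | M i j == 1]| else 0%N.

Definition adjacency_algebra S : {vspace 'M[F]_N} := <<S>>%VS.

(* Representations and characters of the algebra A are encoded by functions   *)
(* on all N x N matrices, of which only the restriction to A is meaningful.   *)
Definition alg_repr (A : {vspace 'M[F]_N}) k (rho : 'M[F]_N -> 'M[F]_k) :
    Prop :=
  [/\ forall c, {in A &, forall M P, rho (c *: M + P) = c *: rho M + rho P},
      rho 1%:M = 1%:M
    & {in A &, {morph rho : M P / M *m P}}].

(* Subspaces are row spaces, as in mxalgebra and mxrepresentation.            *)
Definition alg_irreducible (A : {vspace 'M[F]_N}) k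
    (rho : 'M[F]_N -> 'M[F]_k) : Prop :=
  (0 < k)%N /\
  forall U : 'M[F]_k,
    {in A, forall M, stablemx U (rho M)} -> U != 0 -> row_full U.

Definition irr_character S (chi : 'M[F]_N -> F) : Prop :=
  exists k (rho : 'M[F]_N -> 'M[F]_k),
    [/\ alg_repr (adjacency_algebra S) rho,
        alg_irreducible (adjacency_algebra S) rho
      & {in adjacency_algebra S, forall M, chi M = \tr (rho M)}].

(* chi_0, ..., chi_(r-1) are the elements of Irr(S), without repetition.      *)
Definition enumerates_irr S r (chi : 'I_r -> 'M[F]_N -> F) : Prop :=
  [/\ forall i, irr_character S (chi i),
      forall i j, {in adjacency_algebra S, chi i =1 chi j} -> i = j
    & forall phi, irr_character S phi ->
        exists i, {in adjacency_algebra S, phi =1 chi i}].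

(* The standard character is the trace of the matrix itself.                  *)
Definition multiplicities S r (chi : 'I_r -> 'M[F]_N -> F) (m : 'I_r -> nat) :
    Prop :=
  {in adjacency_algebra S, forall M, \tr M = \sum_i (m i)%:R * chi i M}.

Definition FS_indicator S (chi : 'M[F]_N -> F) (m : nat) : F :=
  m%:R / (N%:R * chi 1%:M) *
    \sum_(M <- S) (valency M)%:R^-1 * chi (M *m M).

End Schemes.

(* The group G of permutation matrices is represented by permutations s, via  *)
(* the multiplicative injection s |-> perm_mx s; see D8x_mx and D8y_mx.       *)
Definition D8x : 'S_4 := perm (@ordS_inj 4).
Definition D8y : 'S_4 :=
  (tperm (inord 0) (inord 1) * tperm (inord 2) (inord 3))%g.

Definition D8 : {group 'S_4} := <<[set D8x; D8y]>>%G.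
Definition D8H : {group 'S_4} := 'C_D8[D8y]%G.

Definition mx_of_rows (R : pzRingType) n (s : seq (seq R)) : 'M[R]_n :=
  \matrix_(i, j) nth 0 (nth [::] s i) j.

Lemma D8x_mx (R : nzRingType) :
  perm_mx D8x = mx_of_rows 4 [:: [:: 0; 1; 0; 0];
                                 [:: 0; 0; 1; 0];
                                 [:: 0; 0; 0; 1];
                                 [:: 1; 0; 0; 0]] :> 'M[R]_4.
Proof.
apply/matrixP=> i j; rewrite !mxE permE -val_eqE /=.
by case: i => [[|[|[|[|]]]] ?] //; case: j => [[|[|[|[|]]]] ?].
Qed.

Lemma D8y_mx (R : nzRingType) :
  perm_mx D8y = mx_of_rows 4 [:: [:: 0; 1; 0; 0];
                                 [:: 1; 0; 0; 0];
                                 [:: 0; 0; 0; 1];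
                                 [:: 0; 0; 1; 0]] :> 'M[R]_4.
Proof.
apply/matrixP=> i j; rewrite !mxE permM !permE /= -!val_eqE /= !inordK //.
by case: i => [[|[|[|[|]]]] ?] //=; case: j => [[|[|[|[|]]]] ?];
  rewrite ?permE /= -?val_eqE /= ?inordK.
Qed.

Section Construction.
Variables (F : fieldType) (a : nat).

(* Here n = a + 1, the blocks have sizes 1 and a, and *t is the Kronecker     *)
(* product.                                                                   *)
Definition mxE0 : 'M[F]_(1 + a) := block_mx 0 (const_mx 1) (const_mx 1) 0.
Definition mxtilde (A : 'M[F]_a) : 'M[F]_(1 + a) := block_mx 0 0 0 A.

Definition sigma (h : 'S_4) : 'M[F]_((1 + a) * 4) := 1%:M *t perm_mx h.

Definition mu (A1 A2 : 'M[F]_a) (g : 'S_4) : 'M[F]_((1 + a) * 4) :=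
  mxE0 *t perm_mx g
  + mxtilde A1 *t perm_mx (g * D8y)%g
  + mxtilde A2 *t perm_mx (g * D8x ^+ 2 * D8y)%g.

Definition schemeD (A1 A2 : 'M[F]_a) : seq 'M[F]_((1 + a) * 4) :=
  [seq sigma h | h in D8H] ++ [seq mu A1 A2 g | g in D8 :\: D8H].

End Construction.

Arguments sigma {F a} h.

(* Main.v *)
(** Put Z = sigma_(x^2), Y = sigma_y and X = mu_x, and let k be the valency of A1,
so that a = 1 + 2k. The scheme D consists of the eight monomials X^s Z^i Y^j with
exponents in {0, 1}, and X, Y, Z satisfy Z^2 = Y^2 = 1, Z central, Y X = X Z Y and
X^2 = a Z + k (X + X Z); the last relation only needs the row and column sums of
A1 and the identity A1^2 + A2^2 = k (A1 + A2). By Schur's lemma Z = 1 or Z = -1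
in an irreducible representation. If Z = 1, then X and Y commute, so they are scalars
with Y = 1 or -1 and (X - a)(X + 1) = 0. If Z = -1, then X and Y anticommute and
X^2 = -a, so X, Y and XY have trace 0, and a fixed vector v of Y spans with v X the
whole space, which has dimension 2. Conversely, all five possibilities occur on
explicit subspaces of the row space that are stable under X, Y, Z. *)

Require Import Defs.
From HB Require Import structures.
From mathcomp Require Import all_boot all_order all_algebra all_fingroup.
From mathcomp Require Import ring.
From mathcomp Require Import mxtens complex reals.

Set Implicit Arguments.
Unset Strict Implicit.
Unset Printing Implicit Defensive.

Import GRing.Theory Num.Theory.
Local Open Scope ring_scope.

(** * The dihedral group *)

Section DihedralGroup.
Local Open Scope group_scope.

Lemma val_D8x i : D8x i = nth 0 [:: 1; 2; 3; 0]%N i :> nat.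
Proof. by rewrite permE; case: i => [[|[|[|[|]]]] ?]. Qed.

Lemma val_D8y i : D8y i = nth 0 [:: 1; 0; 3; 2]%N i :> nat.
Proof.
rewrite permM !permE /= -!val_eqE /= !inordK //.
by case: i => [[|[|[|[|]]]] ?] //=; rewrite ?permE /= -?val_eqE /= ?inordK.
Qed.

Local Notation z := (D8x ^+ 2).

Lemma D8yy : D8y * D8y = 1.
Proof.
(* Only the value tables of the generators are kept, so the identity reduces to looking up lists at
   the four points. *)
move: D8x D8y val_D8x val_D8y => x y vx vy.
apply/permP=> i; apply: val_inj; rewrite !permM perm1 /= ?(vx, vy).
by case: i => [[|[|[|[|]]]] ?].
Qed.

Lemma D8zz : z * z = 1.
Proof.
move: D8x D8y val_D8x val_D8y => x y vx vy.
apply/permP=> i; apply: val_inj; rewrite !permM perm1 /= ?(vx, vy).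
by case: i => [[|[|[|[|]]]] ?].
Qed.

Lemma D8yx : D8y * D8x = D8x * z * D8y.
Proof.
move: D8x D8y val_D8x val_D8y => x y vx vy.
apply/permP=> i; apply: val_inj; rewrite !permM /= ?(vx, vy).
by case: i => [[|[|[|[|]]]] ?].
Qed.

Lemma D8zx : z * D8x = D8x * z. Proof. by rewrite -expgSr -expgS. Qed.

Lemma D8zy : z * D8y = D8y * z.
Proof.
move: D8x D8y val_D8x val_D8y => x y vx vy.
apply/permP=> i; apply: val_inj; rewrite !permM /= ?(vx, vy).
by case: i => [[|[|[|[|]]]] ?].
Qed.

(* Locked, so that rewriting with associativity does not split it. *)
Definition zy (i j : bool) : 'S_4 := locked (z ^+ i * D8y ^+ j).

Lemma zyE i j : zy i j = z ^+ i * D8y ^+ j. Proof. by rewrite /zy -lock. Qed.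

Section Normal.
Variables (gT : finGroupType) (x z y : gT).
Hypotheses (zz : z * z = 1) (yy : y * y = 1) (zyC : z * y = y * z).
Hypotheses (zx : z * x = x * z) (yx : y * x = x * z * y).

(** Carried out in an arbitrary group, so that only the relations matter. Exponents are Booleans
    because [y] and [z] are involutions, and addition modulo 2 is then [(+)]. *)
Lemma normal_monoM (i j i' j' : bool) :
  z ^+ i * y ^+ j * (z ^+ i' * y ^+ j') = z ^+ (i (+) i') * y ^+ (j (+) j').
Proof.
have sq (g : gT) (b b' : bool) : g * g = 1 -> g ^+ b * g ^+ b' = g ^+ (b (+) b').
  by case: b b' => [] [] //= gg; rewrite ?expg0 ?expg1 ?mul1g ?mulg1.
have c : commute (y ^+ j) (z ^+ i') by apply: commuteX2; rewrite /commute zyC.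
by rewrite -mulgA (mulgA (y ^+ j)) c !mulgA sq // -mulgA sq.
Qed.

Lemma normal_monox (i j : bool) :
  z ^+ i * y ^+ j * x = x * (z ^+ (i (+) j) * y ^+ j).
Proof.
case: i j => [] []; rewrite /= ?expg0 ?expg1 ?mul1g ?mulg1 ?zx //.
  by rewrite -mulgA yx !mulgA zx -(mulgA x) zz mulg1.
by rewrite yx mulgA.
Qed.
End Normal.

Lemma zyM i j i' j' : zy i j * zy i' j' = zy (i (+) i') (j (+) j').
Proof. rewrite !zyE; exact: normal_monoM D8zz D8yy D8zy _ _ _ _. Qed.

Lemma zyx i j : zy i j * D8x = D8x * zy (i (+) j) j.
Proof. rewrite !zyE; exact: normal_monox D8zz D8zx D8yx _ _. Qed.

(** The subgroup of the [zy i j] acts regularly on the four points, so the image of the first point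
    tells its elements apart. *)
Lemma val_zy0 i j : zy i j ord0 = (nth 0 (nth [::] [:: [:: 0; 1]; [:: 2; 3]] i) j)%N :> nat.
Proof.
rewrite zyE; move: D8x D8y val_D8x val_D8y => x y vx vy.
by case: i j => [] []; rewrite !(expg0, expg1) !permM ?perm1 /= ?(vx, vy).
Qed.

Lemma zy_inj i j i' j' : zy i j = zy i' j' -> (i, j) = (i', j').
Proof.
move/(congr1 (fun s : 'S_4 => val (s ord0))); rewrite /= !val_zy0.
by case: i j i' j' => [] [] [] [].
Qed.

(** The products in normal form contain both generators and are closed under multiplication: [zyx]
    moves [D8x] to the left, and two factors [D8x] merge into the central square. *)
Lemma D8P g :
  reflect (exists s i j : bool, g = D8x ^+ s * zy i j) (g \in D8).
Proof.
have Dx : D8x \in D8 by rewrite mem_gen ?set21.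
have Dy : D8y \in D8 by rewrite mem_gen ?set22.
apply: (iffP idP) => [|[s [i [j ->]]]]; last by rewrite zyE !groupM ?groupX.
pose T := [set D8x ^+ t.1.1 * zy t.1.2 t.2 | t : bool * bool * bool].
have TP (s i j : bool) : D8x ^+ s * zy i j \in T.
  by apply/imsetP; exists (s, i, j).
have gT : group_set T.
  apply/group_setP; split=> [|_ _ /imsetP[[[s i] j] _ ->] /imsetP[[[s' i'] j'] _ ->] /=].
    by have := TP false false false; rewrite zyE !expg0 !mulg1.
  case: s' => /=; last by rewrite expg0 mul1g -mulgA zyM TP.
  rewrite expg1 -mulgA (mulgA _ D8x) zyx -mulgA zyM.
  case: s => /=; last by rewrite expg0 mul1g; apply: (TP true).
  rewrite expg1 (mulgA D8x) -[D8x * D8x]/z.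
  have -> : z = zy true false by rewrite zyE expg0 mulg1.
  by rewrite zyM -[zy _ _]mul1g; apply: (TP false).
suff /subsetP sDT : D8 \subset Group gT.
  by move=> /sDT /imsetP[[[s i] j] _ ->]; exists s, i, j.
rewrite gen_subG; apply/subsetP=> h /set2P[] -> /=.
  by have := TP true false false; rewrite zyE !expg0 !mulg1 expg1.
by have := TP false false true; rewrite zyE !expg0 !mul1g expg1.
Qed.

Lemma zy00 : zy false false = 1. Proof. by rewrite zyE !expg0 mulg1. Qed.
Lemma zy10 : zy true false = z. Proof. by rewrite zyE !expg0 mulg1. Qed.
Lemma zy01 : zy false true = D8y. Proof. by rewrite zyE !expg0 mul1g. Qed.

(** Moving [D8y] across [D8x] creates a factor [D8x ^+ 2], so the two sides differ in that exponent.
    Hence no element of the coset of [D8x] centralizes [D8y]. *)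
Lemma D8xN1 i j : D8y * (D8x * zy i j) != D8x * zy i j * D8y.
Proof.
have -> : D8y * (D8x * zy i j) = D8x * zy (true (+) i) (true (+) j).
  by rewrite -{1}zy01 mulgA zyx -mulgA zyM.
have -> : D8x * zy i j * D8y = D8x * zy (i (+) false) (j (+) true).
  by rewrite -zyM zy01; apply: esym (mulgA _ _ _).
by apply/eqP=> /mulgI /zy_inj; case: i j => [] [].
Qed.

Lemma D8H_zy : D8H = [set zy b.1 b.2 | b : bool * bool] :> {set _}.
Proof.
apply/setP=> g; apply/setIP/imsetP => [[/D8P[s [i [j ->]]]]|].
  case: s => [/cent1P/esym/eqP|_]; first by rewrite expg1 (negPf (D8xN1 _ _)).
  by exists (i, j); rewrite ?expg0 ?mul1g.
case=> [[i j] _ ->]; split=> /=; first by apply/D8P; exists false, i, j; rewrite mul1g.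
by apply/cent1P; rewrite /commute -zy01 !zyM addbC addFb addbC.
Qed.

Lemma D8DH_zy :
  D8 :\: D8H = [set D8x * zy b.1 b.2 | b : bool * bool] :> {set _}.
Proof.
apply/setP=> g; rewrite D8H_zy; apply/setDP/imsetP => [[/D8P[s [i [j ->]]]]|].
  case: s => [_|/imsetP[]]; first by exists (i, j); rewrite ?expg1.
  by exists (i, j); rewrite ?expg0 ?mul1g.
case=> [[i j] _ ->]; split; first by apply/D8P; exists true, i, j.
rewrite -D8H_zy; apply/negP=> /setIP[_ /cent1P/esym/eqP].
by rewrite (negPf (D8xN1 _ _)).
Qed.

End DihedralGroup.

(** * Irreducible representations *)

Lemma span_ind (F : fieldType) (vT : vectType F) (S : seq vT) (Q : vT -> Prop) :
    Q 0 -> (forall c u v, Q u -> Q v -> Q (c *: u + v)) ->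
    {in S, forall v, Q v} -> {in <<S>>%VS, forall v, Q v}.
Proof.
move=> Q0 QD QS v Sv; rewrite (coord_span (X := in_tuple S) Sv).
elim/big_rec: _ => // i w _ Qw; apply: QD Qw; apply: QS.
by rewrite mem_nth.
Qed.

(** * Representations on stable subspaces, and Schur's lemma *)

Section StableSubspace.
Variables (F : fieldType) (N k : nat) (S : seq 'M[F]_N).
Variables (P : 'M[F]_(k, N)) (Q : 'M[F]_(N, k)).
Hypothesis PQ : P *m Q = 1%:M.

(** The rows of [P] are a basis of a subspace and [Q] extracts coordinates: when the subspace is
    stable, this is the matrix of right multiplication by [M] in that basis. *)
Definition subrep (M : 'M[F]_N) : 'M[F]_k := P *m M *m Q.

Lemma subrep_intertwine M (B : 'M_k) : P *m M = B *m P -> subrep M = B.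
Proof. by rewrite /subrep => ->; rewrite -mulmxA PQ mulmx1. Qed.

Hypothesis stS : {in S, forall M, exists B, P *m M = B *m P}.

Lemma subrep_span : {in <<S>>%VS, forall M, P *m M = subrep M *m P}.
Proof.
apply: span_ind => [|c u v hu hv|M /stS[B PM]].
- by rewrite /subrep !(mulmx0, mul0mx).
- by rewrite mulmxDr -scalemxAr hu hv /subrep mulmxDr !mulmxDl -scalemxAr -!scalemxAl.
- by rewrite (subrep_intertwine PM).
Qed.

Lemma alg_repr_subrep : alg_repr <<S>>%VS subrep.
Proof.
split=> [c M M' _ _||M M' SM SM'].
- by rewrite /subrep mulmxDr mulmxDl -scalemxAr -scalemxAl.
- by rewrite /subrep mulmx1.
- by rewrite [LHS]/subrep mulmxA (subrep_span SM) [X in _ = _ *m X]/subrep -!mulmxA.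
Qed.
End StableSubspace.

Section Irreducible.
Variables (F : fieldType) (N k : nat) (A : {vspace 'M[F]_N}).
Variable rho : 'M[F]_N -> 'M[F]_k.

(** A matrix unit moves a nonzero entry of [U] to any column, so a stable nonzero row space contains
    every basis row. *)
Lemma alg_irreducible_delta :
    (0 < k)%N -> (forall i j, exists2 M, M \in A & rho M = delta_mx i j) ->
  alg_irreducible A rho.
Proof.
move=> k0 surj; split=> // U stU U0.
have /matrix0Pn[i [j Uij]] := U0.
rewrite -sub1mx; apply/row_subP=> l; rewrite row1.
have [M AM rM] := surj j l; have := stU M AM; rewrite rM => sU.
have -> : delta_mx 0 l = (U i j)^-1 *: row i (U *m delta_mx j l) :> 'rV_k.
  apply/rowP=> r; rewrite !mxE (bigD1 j) //= big1 => [|t tj].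
    by rewrite !mxE eqxx addr0 mulrA mulVf ?mul1r.
  by rewrite mxE (negPf tj) mulr0.
by apply: scalemx_sub; apply: submx_trans sU; apply: row_sub.
Qed.
End Irreducible.

Section Schur.
Variables (F : fieldType) (k : nat) (T : seq 'M[F]_k).
Hypothesis irrT : forall U : 'M[F]_k,
  {in T, forall B, stablemx U B} -> U != 0 -> row_full U.

(** The row space of [C] is stable because [C] commutes with [T], so [C] is zero or invertible. In
    this product form of Schur's lemma no algebraic closure enters: factored polynomial relations
    provide the eigenvalues. *)
Lemma irr_commute (C D : 'M[F]_k) :
    {in T, forall B, C *m B = B *m C} -> C *m D = 0 -> C = 0 \/ D = 0.
Proof.
move=> cC CD; have [->|C0] := eqVneq C 0; [by left | right].
have /row_fullP[B BC] : row_full C.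
  by apply: irrT => // B TB; rewrite cC // submxMl.
by rewrite -[D]mul1mx -BC -mulmxA CD mulmx0.
Qed.

Lemma irr_scalar : (0 < k)%N -> {in T, forall B, is_scalar_mx B} -> k = 1.
Proof.
move=> k0 scT; pose i := Ordinal k0.
have /eqP <- : row_full (delta_mx i i : 'M[F]_k).
  apply: irrT => [B /scT/is_scalar_mxP[c ->]|].
    by rewrite mul_mx_scalar scalemx_sub.
  by rewrite -mxrank_eq0 mxrank_delta.
by rewrite mxrank_delta.
Qed.
End Schur.

Lemma involution_tr0 (F : numFieldType) k (Y : 'M[F]_k) :
  Y *m Y = 1%:M -> \tr Y = 0 -> k != 1.
Proof.
move=> YY trY; apply/eqP=> k1; move: Y YY trY; rewrite k1 => Y YY trY.
have := congr1 (fun M : 'M[F]_1 => M 0 0) YY.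
move: trY; rewrite {1 2}[Y]mx11_scalar mxtrace_scalar mulr1n => ->.
by rewrite mul_scalar_mx scale0r !mxE /= => /eqP; rewrite eq_sym oner_eq0.
Qed.

(** * Classification of the irreducible triples satisfying the relations *)

Section Classification.
Variables (F : numFieldType) (a kappa : F) (k : nat) (X Z Y : 'M[F]_k).
Hypotheses (a0 : a != 0) (aE : a = 1 + 2 * kappa).
Hypotheses (ZZ : Z *m Z = 1%:M) (YY : Y *m Y = 1%:M).
Hypotheses (ZX : Z *m X = X *m Z) (ZY : Z *m Y = Y *m Z).
Hypothesis YX : Y *m X = X *m Z *m Y.
Hypothesis XX : X *m X = a *: Z + kappa *: (X + X *m Z).
Hypothesis k0 : (0 < k)%N.
Hypothesis irr : forall U : 'M[F]_k,
  {in [:: X; Z; Y], forall B, stablemx U B} -> U != 0 -> row_full U.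

Lemma mulmx_add1_sub1 (B : 'M[F]_k) : (B + 1%:M) *m (B - 1%:M) = B *m B - 1%:M.
Proof. by rewrite mulmxDl mulmxBr mulmx1 mul1mx addrA subrK. Qed.

Lemma commute_shift (B C : 'M[F]_k) c :
  C *m B = B *m C -> (C + c%:M) *m B = B *m (C + c%:M).
Proof. by move=> e; rewrite mulmxDl mulmxDr e scalar_mxC. Qed.

Lemma irr_involution (C : 'M[F]_k) : C *m C = 1%:M ->
  {in [:: X; Z; Y], forall B, C *m B = B *m C} -> C = 1%:M \/ C = - 1%:M.
Proof.
move=> CC cC.
have cC1 : {in [:: X; Z; Y], forall B, (C + 1%:M) *m B = B *m (C + 1%:M)}.
  by move=> B TB; apply: commute_shift; apply: cC.
have CC1 : (C + 1%:M) *m (C - 1%:M) = 0 by rewrite mulmx_add1_sub1 CC subrr.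
have [/eqP|/eqP] := irr_commute irr cC1 CC1.
- by rewrite addr_eq0 => /eqP; right.
- by rewrite subr_eq0 => /eqP; left.
Qed.

Lemma irr_case1 : Z = 1%:M ->
  exists2 eta, eta \in [:: 1; -1] & exists2 xi, xi \in [:: a; -1] &
    k = 1 /\ Y = eta%:M /\ X = xi%:M.
Proof.
move=> Z1; have YXc : Y *m X = X *m Y by rewrite YX Z1 mulmx1.
have [eta eta1 Ye] : exists2 eta, eta \in [:: 1; -1] & Y = eta%:M.
  have [|->|->] := irr_involution YY; first last.
  - by exists (-1); rewrite ?inE ?eqxx ?orbT // raddfN.
  - by exists 1; rewrite ?inE ?eqxx.
  - by move=> B; rewrite !inE => /or3P[] /eqP -> //; rewrite ZY.
have [xi xi1 Xe] : exists2 xi, xi \in [:: a; -1] & X = xi%:M.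
  have cX : {in [:: X; Z; Y], forall B, (X + 1%:M) *m B = B *m (X + 1%:M)}.
    move=> B; rewrite !inE => BT; apply: commute_shift; move: BT.
    by case/or3P=> /eqP ->.
  (* For Z = 1 the relation reads X^2 = a + 2 kappa X = a + (a - 1) X, which factors. *)
  have XX1 : (X + 1%:M) *m (X - a%:M) = 0.
    rewrite mulmxDl !mulmxBr XX Z1 mulmx1 mul1mx mul1mx aE scalemx1.
    rewrite mul_mx_scalar; apply/matrixP=> i j; rewrite !mxE.
    by move: (X i j) => t; case: (i == j) => /=; rewrite ?mulr1n ?mulr0n; ring.
  have [/eqP|/eqP] := irr_commute irr cX XX1.
  - by rewrite addr_eq0 => /eqP ->; exists (-1); rewrite ?inE ?eqxx ?orbT // raddfN.
  - by rewrite subr_eq0 => /eqP ->; exists a; rewrite ?inE ?eqxx.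
exists eta => //; exists xi => //; split=> //.
apply: (irr_scalar irr) => // B; rewrite !inE.
by case/or3P=> /eqP ->; rewrite ?Ye ?Xe ?Z1 scalar_mx_is_scalar.
Qed.

Lemma irr_caseN1 : Z = - 1%:M ->
  [/\ k = 2, \tr X = 0, \tr Y = 0 & \tr (X *m Y) = 0].
Proof.
move=> Z1; have XYc : Y *m X = - (X *m Y).
  by rewrite YX Z1 mulmxN mulmx1 mulNmx.
have XXa : X *m X = - a%:M.
  by rewrite XX Z1 mulmxN mulmx1 subrr scaler0 addr0 scalerN scalemx1.
have neg0 (t : F) : t = - t -> t = 0.
  by move/eqP; rewrite -addr_eq0 -mulr2n mulrn_eq0 /= => /eqP.
(* Cyclicity of the trace on Y X X gives - a tr Y = a tr Y. *)
have trY : \tr Y = 0.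
  have : \tr (Y *m X *m X) = \tr (X *m (Y *m X)) := mxtrace_mulC _ _.
  rewrite -mulmxA XXa XYc !mulmxN mulmxA XXa mulNmx opprK.
  rewrite mul_mx_scalar mul_scalar_mx raddfN /= => /esym/neg0/eqP.
  by rewrite mxtraceZ mulf_eq0 (negPf a0) => /eqP.
(* Conjugation by the involution Y negates X. *)
have trX : \tr X = 0.
  apply: neg0; rewrite -{1}[X]mulmx1 -YY mulmxA mxtrace_mulC mulmxA XYc.
  by rewrite mulNmx raddfN /= -mulmxA YY mulmx1.
have trXY : \tr (X *m Y) = 0.
  by apply: neg0; rewrite -{1}mxtrace_mulC XYc raddfN.
split=> //.
(* Y = -1 would have trace -k, so Y + 1 has a nonzero row; by Y^2 = 1 each of its rows is fixed by
   Y. *)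
have [i vi] : exists i, row i (Y + 1%:M) != 0.
  apply/existsP; apply: contraT; rewrite negb_exists => /forallP h.
  have /eqP : Y + 1%:M = 0.
    by apply/row_matrixP=> i; rewrite row0; apply/eqP; have := h i; rewrite negbK.
  rewrite addr_eq0 => /eqP Y1; move: trY; rewrite Y1 raddfN /= mxtrace1.
  by move/eqP; rewrite oppr_eq0 pnatr_eq0 => /eqP k00; move: k0; rewrite k00.
set v := row i _ in vi.
have vY : v *m Y = v.
  by rewrite /v -row_mul mulmxDl YY mul1mx addrC.
pose U := (v + v *m X)%MS.
have fullU : row_full U.
  apply: irr => [B|]; last first.
    apply: contraNneq vi => U0; rewrite -submx0 -U0; exact: addsmxSl.
  rewrite /U addsmxMr addsmx_sub !inE => /or3P[] /eqP ->.
  - rewrite addsmxSr -mulmxA XXa mulmxN mul_mx_scalar -scaleNr.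
    by rewrite scalemx_sub // addsmxSl.
  - rewrite Z1 !mulmxN !mulmx1 -!scaleN1r.
    by rewrite !scalemx_sub // ?addsmxSl ?addsmxSr.
  - rewrite vY addsmxSl -mulmxA; have -> : X *m Y = - (Y *m X) by rewrite XYc opprK.
    by rewrite mulmxN mulmxA vY -scaleN1r scalemx_sub // addsmxSr.
have k2 : (k <= 2)%N.
  rewrite -(eqP fullU); apply: leq_trans (mxrank_adds_leqif _ _).1 _.
  by apply: (@leq_add _ _ 1 1); apply: rank_leq_row.
(* Dimension one is excluded: a 1 by 1 matrix of trace zero is zero and is no involution. *)
have := involution_tr0 YY trY.
by move: k0 k2 {fullU}; case: (k) => [|[|[|]]].
Qed.

Lemma irr_cases : Z = 1%:M \/ Z = - 1%:M.
Proof.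
apply: irr_involution => // B; rewrite !inE.
by case/or3P=> /eqP ->.
Qed.
End Classification.

(** * Non-symmetric schemes of rank 3 *)

Lemma mem_span3 (F : fieldType) (vT : vectType F) (u v w t : vT) :
  t \in <<[:: u; v; w]>>%VS -> exists c d e, t = c *: u + d *: v + e *: w.
Proof.
rewrite !span_cons span_nil addv0 => /memv_addP[_ /vlineP[c ->]].
case=> _ /memv_addP[_ /vlineP[d ->] [_ /vlineP[e ->] ->]] ->.
by exists c, d, e; rewrite addrA.
Qed.

Section Tournament.
Variables (F : numFieldType) (a : nat) (A1 A2 : 'M[F]_a).
Hypothesis A2E : A2 = A1^T.
Hypothesis sch : assoc_scheme [:: 1%:M; A1; A2].

Lemma scheme_sum : 1%:M + A1 + A2 = const_mx 1.
Proof. by case: sch => _ _ [_ <-] _ _; rewrite !big_cons big_nil addr0 addrA. Qed.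

Lemma scheme_01 i j : A1 i j \in [:: 0; 1].
Proof.
by case: sch => _ h _ _ _; apply: (h A1 _).2; rewrite !inE eqxx ?orbT.
Qed.

Lemma scheme_gt0 : (0 < a)%N.
Proof.
have m1 : A1 \in [:: 1%:M; A1; A2] by rewrite !inE eqxx ?orbT.
case: sch => _ h _ _ _; have [/eqP+ _] := h A1 m1.
rewrite lt0n; apply: contra_notN => /eqP a0.
by apply/matrixP=> i; have := ltn_ord i; rewrite [X in (_ < X)%N]a0.
Qed.

(** Entrywise form of the sum relation: together with the 0/1 condition, it makes [A1] the adjacency
    matrix of a tournament. *)
Lemma scheme_entry i j : (i == j)%:R + A1 i j + A1 j i = 1.
Proof. by have /matrixP/(_ i j) := scheme_sum; rewrite A2E !mxE. Qed.

Lemma scheme_diag1 i : A1 i i = 0.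
Proof.
have := scheme_entry i i; rewrite eqxx -addrA -[RHS]addr0 => /addrI/eqP.
by rewrite -mulr2n mulrn_eq0 /= => /eqP.
Qed.

Lemma scheme_skew i j : A1 i j * A1 j i = 0.
Proof.
have := scheme_entry i j; have := scheme_01 i j; have := scheme_01 j i.
rewrite !inE => /orP[] /eqP -> /orP[] /eqP ->; rewrite ?mulr0 ?mul0r // mulr1.
by rewrite -[RHS]add0r => /addIr/eqP; rewrite paddr_eq0 ?ler0n // oner_eq0 andbF.
Qed.

Lemma scheme_diag2 i : A2 i i = 0.
Proof. by rewrite A2E mxE scheme_diag1. Qed.

(** The source of regularity: since entries are idempotent, the diagonals of [A1 *m A2] and
    [A2 *m A1] hold the row sums and the column sums of [A1]. *)
Lemma span_diag M : M \in <<[:: 1%:M; A1; A2]>>%VS -> forall i j, M i i = M j j.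
Proof.
move=> /mem_span3[c [d [e ->]]] i j.
by rewrite !mxE !scheme_diag1 !scheme_diag2 !eqxx.
Qed.

Lemma scheme_mul M P : M \in [:: 1%:M; A1; A2] -> P \in [:: 1%:M; A1; A2] ->
  M *m P \in <<[:: 1%:M; A1; A2]>>%VS.
Proof. by case: sch => _ _ _ _; apply. Qed.

Lemma scheme_params : exists kappa : F,
  [/\ a%:R = 1 + 2 * kappa,
      forall i, \sum_j A1 i j = kappa,
      forall j, \sum_i A1 i j = kappa
    & A1 *m A1 + A2 *m A2 = kappa *: (A1 + A2)].
Proof.
pose i0 := Ordinal scheme_gt0.
have m1 : A1 \in [:: 1%:M; A1; A2] by rewrite !inE eqxx ?orbT.
have m2 : A2 \in [:: 1%:M; A1; A2] by rewrite !inE eqxx ?orbT.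
have sq i j : A1 i j * A1 i j = A1 i j.
  by have := scheme_01 i j; rewrite !inE => /orP[] /eqP ->; rewrite ?mulr0 ?mulr1.
pose kappa := \sum_j A1 i0 j.
have rowsum i : \sum_j A1 i j = kappa.
  have := span_diag (scheme_mul m1 m2) i i0; rewrite A2E !mxE.
  by under eq_bigr do rewrite mxE sq; under [in X in _ = X]eq_bigr do rewrite mxE sq.
have cs0 j : \sum_i A1 i j = \sum_i A1 i i0.
  have := span_diag (scheme_mul m2 m1) j i0; rewrite A2E !mxE.
  by under eq_bigr do rewrite mxE sq; under [in X in _ = X]eq_bigr do rewrite mxE sq.
have a0 : a%:R != 0 :> F by rewrite pnatr_eq0 -lt0n scheme_gt0.
have sum_const (c : F) : \sum_(i < a) c = a%:R * c.
  by rewrite sumr_const card_ord mulr_natl.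
(* Counting all the ones of [A1] by rows and by columns identifies the two constants. *)
have colsum j : \sum_i A1 i j = kappa.
  rewrite cs0; apply: (mulfI a0); rewrite -!sum_const.
  under eq_bigr => i _ do rewrite -(cs0 i).
  by under [RHS]eq_bigr => i _ do rewrite -(rowsum i); rewrite exchange_big.
have aE : a%:R = 1 + 2 * kappa.
  have : \sum_j ((i0 == j)%:R + A1 i0 j + A1 j i0) = a%:R.
    by under eq_bigr do rewrite scheme_entry; rewrite sum_const mulr1.
  rewrite !big_split /= rowsum colsum (bigD1 i0) //= big1 => [|j]; last first.
    by rewrite eq_sym => /negPf ->.
  by rewrite ?eqxx addr0 => <-; rewrite mulr_natl mulr2n addrA.
exists kappa; split=> //.
have [al [be [ga A11]]] := mem_span3 (scheme_mul m1 m1).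
(* The diagonal of A1^2 vanishes because no pair of points is joined in both directions. Transposing
   then gives A2^2 with the same coefficients. *)
have al0 : al = 0.
  have /matrixP/(_ i0 i0) := A11; rewrite !mxE scheme_diag1 scheme_diag2 eqxx.
  by rewrite big1 => [|j _]; rewrite ?scheme_skew // !mulr0 !addr0 mulr1.
have A22 : A2 *m A2 = be *: A2 + ga *: A1.
  by rewrite A2E -trmx_mul A11 al0 scale0r add0r linearD /= !linearZ /= A2E trmxK.
have sumE : A1 *m A1 + A2 *m A2 = (be + ga) *: (A1 + A2).
  by rewrite A22 A11 al0; apply/matrixP=> i j; rewrite !mxE; ring.
(* Nonnegative entries with zero row sums would make [A1] the zero matrix. *)
have kap0 : kappa != 0.
  apply/eqP=> k0; case: sch => _ /(_ A1 m1)[/eqP + _] _ _ _; apply.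
  apply/matrixP=> i j; rewrite mxE; apply/eqP.
  have nn l : l \in predT -> 0 <= A1 i l.
    by have := scheme_01 i l; rewrite !inE => /orP[] /eqP ->; rewrite ?ler01.
  have /eqP := rowsum i; rewrite k0 psumr_eq0 // => /allP /(_ j).
  by rewrite mem_index_enum => /(_ isT).
(* Row sums on both sides of [sumE] give 2 kappa^2 = 2 (be + ga) kappa, from which kappa is
   cancelled. *)
suff -> : kappa = be + ga by [].
have rs2 i : \sum_j A2 i j = kappa by rewrite A2E -(colsum i); under eq_bigr do rewrite mxE.
have mulsum (M P : 'M[F]_a) : (forall i, \sum_j M i j = kappa) ->
    (forall i, \sum_j P i j = kappa) ->
  forall i, \sum_j (M *m P) i j = kappa * kappa.
  move=> hM hP i; under eq_bigr do rewrite mxE; rewrite exchange_big /=.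
  by under eq_bigr do rewrite -mulr_sumr hP; rewrite -mulr_suml hM.
have : \sum_j (A1 *m A1 + A2 *m A2) i0 j = \sum_j ((be + ga) *: (A1 + A2)) i0 j.
  by rewrite sumE.
under eq_bigr do rewrite mxE; rewrite big_split /= !mulsum //.
under eq_bigr do rewrite 2!mxE; rewrite -mulr_sumr big_split /= rowsum rs2.
rewrite -mulrDr; apply: mulIf.
by rewrite -mulr2n mulrn_eq0.
Qed.
End Tournament.

(** * Relations between the generators *)

Section Tensor.
Variable R : comPzRingType.

Lemma tensmxDl m n p q (A B : 'M[R]_(m, n)) (C : 'M_(p, q)) :
  (A + B) *t C = A *t C + B *t C.
Proof. by apply/matrixP=> i j; rewrite !mxE mulrDl. Qed.

Lemma tensmxDr m n p q (A : 'M[R]_(m, n)) (B C : 'M_(p, q)) :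
  A *t (B + C) = A *t B + A *t C.
Proof. by apply/matrixP=> i j; rewrite !mxE mulrDr. Qed.

Lemma tensmxZl m n p q c (A : 'M[R]_(m, n)) (B : 'M_(p, q)) :
  (c *: A) *t B = c *: (A *t B).
Proof. by apply/matrixP=> i j; rewrite !mxE mulrA. Qed.

Lemma sum_mxtens m n (f : 'I_(m * n) -> R) :
  \sum_k f k = \sum_i \sum_j f (mxtens_index (i, j)).
Proof.
rewrite pair_big /= (reindex (@mxtens_index m n)) /=.
  by apply: eq_bigr => -[].
by exists (@mxtens_unindex m n) => k _; rewrite ?mxtens_indexK ?mxtens_unindexK.
Qed.

Lemma mxtrace_tens m n (A : 'M[R]_m) (B : 'M[R]_n) :
  \tr (A *t B) = \tr A * \tr B.
Proof.
rewrite /mxtrace sum_mxtens big_distrl /=; apply: eq_bigr => i _.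
by rewrite big_distrr /=; apply: eq_bigr => j _; rewrite !mxE !mxtens_indexK.
Qed.

Lemma tensmx11 m n : 1%:M *t 1%:M = 1%:M :> 'M[R]_(m * n).
Proof.
apply/matrixP=> i j; case: (mxtens_indexP i) => {}i i'; case: (mxtens_indexP j) => {}j j'.
rewrite tensmxE !mxE (can_eq (@mxtens_indexK m n)).
by rewrite xpair_eqE -mulnb natrM.
Qed.
End Tensor.

Lemma row4_D8x (R : nzRingType) (s0 s1 s2 s3 : R) :
  (\row_j nth 0 [:: s0; s1; s2; s3] j) *m perm_mx D8x =
  \row_j nth 0 [:: s3; s0; s1; s2] j.
Proof.
rewrite D8x_mx; apply/rowP=> j; rewrite !mxE !big_ord_recl big_ord0 !mxE /=.
by case: j => [[|[|[|[|]]]] ?] //=; rewrite !(mulr0, mulr1, add0r, addr0).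
Qed.

Lemma row4_D8y (R : nzRingType) (s0 s1 s2 s3 : R) :
  (\row_j nth 0 [:: s0; s1; s2; s3] j) *m perm_mx D8y =
  \row_j nth 0 [:: s1; s0; s3; s2] j.
Proof.
rewrite D8y_mx; apply/rowP=> j; rewrite !mxE !big_ord_recl big_ord0 !mxE /=.
by case: j => [[|[|[|[|]]]] ?] //=; rewrite !(mulr0, mulr1, add0r, addr0).
Qed.

(** The two factors [D8x] merge into their square, whence the negation in the first exponent. *)
Lemma xzyM i j i' j' :
  (D8x * zy i j * (D8x * zy i' j') = zy (~~ (i (+) j (+) i')) (j (+) j'))%g.
Proof.
rewrite mulgA -(mulgA D8x (zy i j)) zyx (mulgA D8x D8x) -mulgA zyM.
have -> : (D8x * D8x)%g = zy true false by rewrite zy10.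
by rewrite zyM addTb.
Qed.

(* The group ring element x + x^3 - y - x^2 y acts as zero on the four points:
   [x + x^3] and [y + x^2 y] are both the adjacency matrix of a 4-cycle. This
   is why the span of D is closed under products. *)
Lemma perm_mx_coset (R : nzRingType) j :
  perm_mx (D8x * zy false j)%g + perm_mx (D8x * zy true j)%g =
  perm_mx (zy false (~~ j)) + perm_mx (zy true (~~ j)) :> 'M[R]_4.
Proof.
rewrite !zyE; move: D8x D8y val_D8x val_D8y => x y vx vy.
apply/matrixP=> r c; rewrite !mxE -!val_eqE /=.
case: j; rewrite /= !(expg0, expg1) !permM ?perm1 /= ?(vx, vy);
  case: r => [[|[|[|[|]]]] ?] //=; case: c => [[|[|[|[|]]]] ?] //=;
  by rewrite ?addr0 ?add0r.
Qed.

Section Relations.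
Variables (F : numFieldType) (a : nat) (A1 A2 : 'M[F]_a).

Local Notation E := (mxE0 F a).
Local Notation T1 := (mxtilde A1).
Local Notation T2 := (mxtilde A2).
Local Notation X := (mu A1 A2 D8x).
Local Notation Z := (@sigma F a (D8x ^+ 2)%g).
Local Notation Y := (@sigma F a D8y).

Lemma sigmaM g h : @sigma F a g *m sigma h = sigma (g * h)%g.
Proof. by rewrite /sigma tensmx_mul mul1mx -perm_mxM. Qed.

Lemma sigma1 : @sigma F a 1%g = 1%:M.
Proof. by rewrite /sigma perm_mx1 tensmx11. Qed.

Lemma mu_zy i j : mu A1 A2 (D8x * zy i j)%g =
  E *t perm_mx (D8x * zy i j)%g + T1 *t perm_mx (D8x * zy i (~~ j))%g
  + T2 *t perm_mx (D8x * zy (~~ i) (~~ j))%g.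
Proof.
rewrite /mu -zy10 -zy01 -!mulgA !zyM.
by rewrite [i (+) (true (+) false)]addbC [j (+) (false (+) true)]addbC addbF.
Qed.

Lemma mu_x : X =
  E *t perm_mx (D8x * zy false false)%g + T1 *t perm_mx (D8x * zy false true)%g
  + T2 *t perm_mx (D8x * zy true true)%g.
Proof. by rewrite -mu_zy zy00 mulg1. Qed.

Lemma mu_sigma i j : X *m sigma (zy i j) = mu A1 A2 (D8x * zy i j)%g.
Proof.
rewrite mu_zy mu_x /sigma !mulmxDl !tensmx_mul !mulmx1 -!perm_mxM -!mulgA !zyM.
by rewrite !addTb !addFb.
Qed.

Lemma sigma_mu i j : sigma (zy i j) *m X = X *m sigma (zy (i (+) j) j).
Proof.
rewrite mu_sigma mu_zy mu_x /sigma !mulmxDr !tensmx_mul !mul1mx -!perm_mxM.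
rewrite !mulgA !zyx -!mulgA !zyM.
by rewrite ![_ (+) false]addbC ![_ (+) true]addbC !addTb !addFb.
Qed.

Variable kappa : F.
Hypothesis aE : a%:R = 1 + 2 * kappa.
Hypothesis A2E : A2 = A1^T.
Hypothesis sumA : 1%:M + A1 + A2 = const_mx 1.
Hypothesis rowsum : forall i, \sum_j A1 i j = kappa.
Hypothesis colsum : forall j, \sum_i A1 i j = kappa.
Hypothesis sqA : A1 *m A1 + A2 *m A2 = kappa *: (A1 + A2).

Lemma A1J m : A1 *m const_mx 1 = const_mx kappa :> 'M_(a, m).
Proof.
apply/matrixP=> i j; rewrite !mxE -(rowsum i).
by apply: eq_bigr => l _; rewrite mxE mulr1.
Qed.

Lemma JA1 m : const_mx 1 *m A1 = const_mx kappa :> 'M_(m, a).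
Proof.
apply/matrixP=> i j; rewrite !mxE -(colsum j).
by apply: eq_bigr => l _; rewrite mxE mul1r.
Qed.

Lemma A2J m : A2 *m const_mx 1 = const_mx kappa :> 'M_(a, m).
Proof. by rewrite A2E -[const_mx 1]trmx_const -trmx_mul JA1 trmx_const. Qed.

Lemma JA2 m : const_mx 1 *m A2 = const_mx kappa :> 'M_(m, a).
Proof. by rewrite A2E -[const_mx 1]trmx_const -trmx_mul A1J trmx_const. Qed.

(** [ET1], [ET2], [TT] and [ET] give the left tensor factors of the four elements of H in the
    expansion of X^2. *)
Lemma ET1 : E *m T1 + T2 *m E = kappa *: E.
Proof.
rewrite /mxE0 /mxtilde !mulmx_block !(mulmx0, mul0mx, addr0, add0r).
rewrite JA1 A2J scale_block_mx add_block_mx !(scaler0, addr0, add0r).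
by congr block_mx; apply/matrixP=> i j; rewrite !mxE mulr1.
Qed.

Lemma ET2 : E *m T2 + T1 *m E = kappa *: E.
Proof.
rewrite /mxE0 /mxtilde !mulmx_block !(mulmx0, mul0mx, addr0, add0r).
rewrite JA2 A1J scale_block_mx add_block_mx !(scaler0, addr0, add0r).
by congr block_mx; apply/matrixP=> i j; rewrite !mxE mulr1.
Qed.

Lemma TT : T1 *m T1 + T2 *m T2 = kappa *: (T1 + T2).
Proof.
rewrite /mxtilde !mulmx_block !(mulmx0, mul0mx, addr0, add0r).
by rewrite !add_block_mx scale_block_mx !(scaler0, addr0) sqA.
Qed.

Lemma ET : E *m E + T1 *m T2 + T2 *m T1 = a%:R%:M + kappa *: (T1 + T2).
Proof.
rewrite /mxE0 /mxtilde !mulmx_block !(mulmx0, mul0mx, addr0, add0r).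
rewrite !add_block_mx scale_block_mx !(scaler0, addr0).
rewrite [in RHS]scalar_mx_block add_block_mx !addr0; congr block_mx.
  by apply/matrixP=> i j; rewrite !ord1 !mxE; under eq_bigr do rewrite !mxE mulr1;
     rewrite sumr_const card_ord mulr1n.
(* The mixed products come from A1 J = A2 J = kappa J with J = 1 + A1 + A2, so that only the sum of
   the two squares has to be known. *)
have A12 : A1 *m A2 = const_mx kappa - A1 - A1 *m A1.
  by rewrite -A1J -sumA !mulmxDr mulmx1; apply/matrixP=> i j; rewrite !mxE; ring.
have A21 : A2 *m A1 = const_mx kappa - A2 - A2 *m A2.
  by rewrite -A2J -sumA !mulmxDr mulmx1; apply/matrixP=> i j; rewrite !mxE; ring.
have -> : const_mx 1 *m (const_mx 1 : 'rV_a) = const_mx 1 :> 'M[F]_a.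
  by apply/matrixP=> i j; rewrite !mxE big_ord1 !mxE mulr1.
have A22 : A2 *m A2 = kappa *: (A1 + A2) - A1 *m A1 by rewrite -sqA addrC addKr.
rewrite A12 A21 A22 -[a%:R%:M]mulmx1 mul_scalar_mx.
have -> : const_mx kappa = kappa *: (1%:M + A1 + A2) :> 'M_a.
  by rewrite sumA; apply/matrixP=> i j; rewrite !mxE mulr1.
by rewrite -sumA aE; apply/matrixP=> i j; rewrite !mxE; ring.
Qed.

Lemma muXX : X *m X = a%:R *: Z + kappa *: (X + X *m Z).
Proof.
rewrite -zy10 mu_sigma mu_zy mu_x !(mulmxDl, mulmxDr) !tensmx_mul -!perm_mxM !xzyM /=.
have c0 := perm_mx_coset F false; have c1 := perm_mx_coset F true.
rewrite /= in c0 c1.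
have W : a%:R *: sigma (zy true false) =
    (a%:R%:M) *t perm_mx (zy true false) :> 'M[F]_((1 + a) * 4).
  by rewrite /sigma -tensmxZl scalemx1.
rewrite W; move: c0 c1.
set w00 := perm_mx (zy false false); set w01 := perm_mx (zy false true).
set w10 := perm_mx (zy true false); set w11 := perm_mx (zy true true).
set x00 := perm_mx _; set x10 := perm_mx _ => c0.
set x01 := perm_mx _; set x11 := perm_mx _ => c1.
(* The nine terms of the expansion are collected by the element of H in the right factor. *)
transitivity ((E *m E + T1 *m T2 + T2 *m T1) *t w10 + (T1 *m T1 + T2 *m T2) *t w00
  + (E *m T1 + T2 *m E) *t w11 + (E *m T2 + T1 *m E) *t w01).
  by apply/matrixP=> r c; rewrite !tensmxDl !mxE; ring.
rewrite ET TT ET1 ET2.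
(* [c0] and [c1] exchange sums over pairs in H for sums over pairs in the other coset, which is
   where X + X Z reappears. *)
transitivity (a%:R%:M *t w10 + kappa *: (E *t (x00 + x10) + (T1 + T2) *t (x01 + x11))).
  rewrite c0 c1 !(tensmxDl, tensmxDr, tensmxZl, scalerDr).
  by apply/matrixP=> r c; rewrite !mxE; ring.
rewrite !(tensmxDl, tensmxDr, scalerDr).
by apply/matrixP=> r c; rewrite !mxE; ring.
Qed.
End Relations.

(** * The adjacency algebra of D *)

(** The power of [M] with Boolean exponent, so that [mono] is the monomial X^s Z^i Y^j. *)
Definition cnd (R : pzRingType) k (b : bool) (M : 'M[R]_k) : 'M[R]_k :=
  if b then M else 1%:M.

Definition mono (R : pzRingType) k (X Z Y : 'M[R]_k) (s i j : bool) : 'M[R]_k :=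
  cnd s X *m (cnd i Z *m cnd j Y).

Lemma mono_intertwine (R : pzRingType) k N (P : 'M[R]_(k, N)) X Z Y BX BZ BY s i j :
    P *m X = BX *m P -> P *m Z = BZ *m P -> P *m Y = BY *m P ->
  P *m mono X Z Y s i j = mono BX BZ BY s i j *m P.
Proof.
have h b (M : 'M[R]_N) B : P *m M = B *m P -> P *m cnd b M = cnd b B *m P.
  by case: b; rewrite //= mulmx1 mul1mx.
move=> /(h s) hX /(h i) hZ /(h j) hY.
by rewrite /mono !mulmxA hX -(mulmxA _ P) hZ -!mulmxA hY !mulmxA.
Qed.

Lemma mono_scalar (R : comPzRingType) k (x z y : R) s i j :
  mono x%:M z%:M y%:M s i j =
  ((if s then x else 1) * ((if i then z else 1) * (if j then y else 1)))%:M :> 'M_k.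
Proof.
have c b (t : R) : cnd b t%:M = (if b then t else 1)%:M :> 'M_k by case: b.
by rewrite /mono !c -!scalar_mxM.
Qed.

Section MonoTrace.
Variables (F : fieldType) (k : nat) (X Y : 'M[F]_k).
Hypotheses (k2 : k = 2) (trX : \tr X = 0) (trY : \tr Y = 0).
Hypothesis trXY : \tr (X *m Y) = 0.

(** Applies both to the explicit plane and to any irreducible representation with Z = -1, so their
    characters are compared without constructing an isomorphism. *)
Lemma mono_trace s i j :
  \tr (mono X (- 1%:M) Y s i j) = if s || j then 0 else (-1) ^+ i *+ 2.
Proof.
have tr1 : \tr (1%:M : 'M[F]_k) = 1 *+ 2 by rewrite mxtrace1 k2.
rewrite /mono /cnd; case: s i j => [] [] [] /=;
  rewrite ?(mulmxN, mulNmx, mul1mx, mulmx1) ?raddfN /= ?trX ?trY ?trXY ?oppr0 //.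
by rewrite tr1 expr1 mulNrn.
Qed.

Variable a : F.
Hypotheses (YY : Y *m Y = 1%:M) (XX : X *m X = - a%:M).
Hypothesis YX : Y *m X = - (X *m Y).

(** The sign from Z disappears in the square, while anticommutation gives (X Y)^2 = - X^2 = a. *)
Lemma mono_sq_trace s i j (M := mono X (- 1%:M) Y s i j) :
  \tr (M *m M) = (if s then (if j then a else - a) else 1) *+ 2.
Proof.
have sc c : \tr (c%:M : 'M[F]_k) = c *+ 2 by rewrite mxtrace_scalar k2.
have XYXY : X *m Y *m (X *m Y) = a%:M.
  by rewrite mulmxA -(mulmxA X) YX mulmxN mulNmx !mulmxA XX !mulNmx opprK -mulmxA YY mulmx1.
rewrite {}/M /mono /cnd; case: s i j => [] [] [] /=;
  rewrite ?(mulmxN, mulNmx, mul1mx, mulmx1, opprK) ?XX ?YY ?XYXY ?raddfN /= ?sc //.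
all: by rewrite mulNrn.
Qed.
End MonoTrace.

Lemma big_D8H (V : nmodType) (f : 'S_4 -> V) :
  \sum_(h in D8H) f h = \sum_i \sum_j f (zy i j).
Proof.
rewrite pair_big (eq_bigl (mem [set zy b.1 b.2 | b : bool * bool])) => [|h].
  rewrite big_imset //=.
  by move=> [i j] [i' j'] _ _ /zy_inj.
by rewrite /= -D8H_zy.
Qed.

Lemma big_D8DH (V : nmodType) (f : 'S_4 -> V) :
  \sum_(g in D8 :\: D8H) f g = \sum_i \sum_j f (D8x * zy i j)%g.
Proof.
rewrite pair_big /= D8DH_zy big_imset //=.
by move=> [i j] [i' j'] _ _ /mulgI/zy_inj.
Qed.

Section Scheme.
Variables (F : numFieldType) (a : nat) (A1 A2 : 'M[F]_a).

Local Notation X := (mu A1 A2 D8x).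
Local Notation Z := (@sigma F a (D8x ^+ 2)%g).
Local Notation Y := (@sigma F a D8y).
Local Notation smon := (mono X Z Y).

Lemma smon0 i j : smon false i j = sigma (zy i j).
Proof.
rewrite /mono mul1mx /cnd -zy10 -zy01.
by case: i j => [] []; rewrite ?sigmaM ?zyM ?mulmx1 ?mul1mx // zy00 sigma1.
Qed.

Lemma smon1 i j : smon true i j = mu A1 A2 (D8x * zy i j)%g.
Proof. by rewrite -mu_sigma -smon0 /mono mul1mx. Qed.

Lemma big_schemeD (V : nmodType) (f : 'M[F]_((1 + a) * 4) -> V) :
  \sum_(M <- schemeD A1 A2) f M = \sum_s \sum_i \sum_j f (smon s i j).
Proof.
rewrite big_cat /= !big_image /= big_D8H big_D8DH [RHS]big_bool [RHS]addrC /=.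
by congr (_ + _); apply: eq_bigr => i _; apply: eq_bigr => j _;
  rewrite ?smon0 ?smon1.
Qed.

Lemma schemeDP M :
  reflect (exists s i j, M = smon s i j) (M \in schemeD A1 A2).
Proof.
apply: (iffP idP) => [|[s [i [j ->]]]].
  rewrite mem_cat => /orP[] /imageP[g]; rewrite ?D8DH_zy ?D8H_zy.
    by case/imsetP=> -[i j] _ -> ->; exists false, i, j; rewrite smon0.
  by case/imsetP=> -[i j] _ -> ->; exists true, i, j; rewrite smon1.
rewrite mem_cat; apply/orP; case: s; [right|left]; apply/imageP.
  by exists (D8x * zy i j)%g; rewrite ?smon1 // D8DH_zy; apply/imsetP; exists (i, j).
by exists (zy i j); rewrite ?smon0 // D8H_zy; apply/imsetP; exists (i, j).
Qed.

Local Notation A := (adjacency_algebra (schemeD A1 A2)).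

Lemma mem_smon s i j : smon s i j \in A.
Proof. by apply: memv_span; apply/schemeDP; exists s, i, j. Qed.

(** Membership in [A] is carried along the induction, because representations are linear only
    there. *)
Lemma smon_ind (Q : 'M[F]_((1 + a) * 4) -> Prop) :
    Q 0 -> (forall c, {in A &, forall M P, Q M -> Q P -> Q (c *: M + P)}) ->
    (forall s i j, Q (smon s i j)) -> {in A, forall M, Q M}.
Proof.
move=> Q0 QD Qs M AM; suff [] : M \in A /\ Q M by [].
move: M AM; apply: span_ind => [|c u v [Au Qu] [Av Qv]|M /schemeDP[s [i [j ->]]]].
- by rewrite mem0v.
- by split; [apply: memvD => //; apply: memvZ | apply: QD].
- by rewrite mem_smon.
Qed.

Lemma repr_smon k (rho : _ -> 'M_k) s i j :
  alg_repr A rho -> rho (smon s i j) = mono (rho X) (rho Z) (rho Y) s i j.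
Proof.
case=> _ rho1 rhoM.
have AX : X \in A by have := mem_smon true false false; rewrite /mono /= !mulmx1.
have AZ : Z \in A by have := mem_smon false true false; rewrite /mono /= !mulmx1 mul1mx.
have AY : Y \in A by have := mem_smon false false true; rewrite /mono /= !mul1mx.
have A1' : 1%:M \in A by have := mem_smon false false false; rewrite /mono /= !mul1mx.
have Ac b M : M \in A -> cnd b M \in A by case: b.
have rc b M : rho (cnd b M) = cnd b (rho M) by case: b.
have AZY : cnd i Z *m cnd j Y \in A by have := mem_smon false i j; rewrite /mono mul1mx.
by rewrite /mono !rhoM ?rc ?Ac.
Qed.

Lemma repr_trace_eq k (rho : _ -> 'M_k) k' (rho' : _ -> 'M_k') :
    alg_repr A rho -> alg_repr A rho' ->
    (forall s i j, \tr (rho (smon s i j)) = \tr (rho' (smon s i j))) ->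
  {in A, forall M, \tr (rho M) = \tr (rho' M)}.
Proof.
move=> [lin _ _] [lin' _ _] eqs; apply: smon_ind => // [|c M P AM AP eM eP].
  have r0 q (r : _ -> 'M[F]_q) :
      (forall c, {in A &, forall M P, r (c *: M + P) = c *: r M + r P}) -> r 0 = 0.
    move=> lr; have := lr (-1) 0 0 (mem0v _) (mem0v _).
    by rewrite scaler0 addr0 scaleN1r addNr.
  by rewrite !r0 // !mxtrace0.
by rewrite lin // lin' // !mxtraceD !mxtraceZ eM eP.
Qed.
End Scheme.

(* The Kronecker product of two rows, with height [1] rather than [1 * 1]. *)
Definition row_tens (R : pzRingType) m n (v : 'rV[R]_m) (s : 'rV_n) : 'rV_(m * n) :=
  v *t s.

Section RowTens.
Variables (R : comPzRingType) (m n : nat).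
Implicit Types (v w : 'rV[R]_m) (s t : 'rV[R]_n).

Lemma row_tensDl v w s : row_tens (v + w) s = row_tens v s + row_tens w s.
Proof. by apply/matrixP=> i j; rewrite !mxE mulrDl. Qed.

Lemma row_tens0 s : row_tens (0 : 'rV[R]_m) s = 0.
Proof. by apply/matrixP=> i j; rewrite !mxE mul0r. Qed.

Lemma row_tensZl c v s : row_tens (c *: v) s = c *: row_tens v s.
Proof. by apply/matrixP=> i j; rewrite !mxE mulrA. Qed.

Lemma row_tensZr c v s : row_tens v (c *: s) = c *: row_tens v s.
Proof. by apply/matrixP=> i j; rewrite !mxE mulrCA. Qed.

Lemma row_tens_mul p q v s (M : 'M_(m, p)) (P : 'M_(n, q)) :
  row_tens v s *m (M *t P) = row_tens (v *m M) (s *m P).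
Proof. exact: (@tensmx_mul R 1 m 1 n p q v s M P). Qed.

Lemma row_tensE v s i j : row_tens v s 0 (mxtens_index (i, j)) = v 0 i * s 0 j.
Proof. by rewrite mxE mxtens_indexK !ord1. Qed.
End RowTens.

(** * The five characters *)

Lemma row4_z (R : nzRingType) (s0 s1 s2 s3 : R) :
  (\row_j nth 0 [:: s0; s1; s2; s3] j) *m perm_mx (D8x ^+ 2)%g =
  \row_j nth 0 [:: s2; s3; s0; s1] j.
Proof. by rewrite expgS expg1 perm_mxM mulmxA !row4_D8x. Qed.

(** The three group elements are those attached to [E], [T1] and [T2] in [mu_x]. *)
Lemma row4_xzy (R : nzRingType) (s0 s1 s2 s3 : R)
    (s := \row_j nth 0 [:: s0; s1; s2; s3] j) :
  [/\ s *m perm_mx (D8x * zy false false)%g = \row_j nth 0 [:: s3; s0; s1; s2] j,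
      s *m perm_mx (D8x * zy false true)%g = \row_j nth 0 [:: s0; s3; s2; s1] j
    & s *m perm_mx (D8x * zy true true)%g = \row_j nth 0 [:: s2; s1; s0; s3] j].
Proof.
have h g : s *m perm_mx (D8x * g)%g = (\row_j nth 0 [:: s3; s0; s1; s2] j) *m perm_mx g.
  by rewrite perm_mxM mulmxA row4_D8x.
split; rewrite h; first by rewrite zy00 perm_mx1 mulmx1.
  by rewrite zy01 row4_D8y.
have -> : zy true true = (zy true false * zy false true)%g by rewrite zyM.
by rewrite perm_mxM mulmxA zy10 row4_z zy01 row4_D8y.
Qed.

Lemma row4_scale (R : nzRingType) (c s0 s1 s2 s3 : R) :
  \row_j nth 0 [:: c * s0; c * s1; c * s2; c * s3] j =
  c *: \row_(j < 4) nth 0 [:: s0; s1; s2; s3] j.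
Proof.
by apply/rowP=> j; rewrite !mxE; case: j => [[|[|[|[|]]]] ?].
Qed.

Section Characters.
Variables (F : numFieldType) (a : nat) (A1 A2 : 'M[F]_a) (kappa : F).
Hypothesis a_gt0 : (0 < a)%N.
Hypothesis aE : a%:R = 1 + 2 * kappa.
Hypothesis A2E : A2 = A1^T.
Hypothesis sumA : 1%:M + A1 + A2 = const_mx 1.
Hypothesis rowsum : forall i, \sum_j A1 i j = kappa.
Hypothesis colsum : forall j, \sum_i A1 i j = kappa.
Hypothesis sqA : A1 *m A1 + A2 *m A2 = kappa *: (A1 + A2).

Local Notation N := ((1 + a) * 4)%N.
Local Notation E := (mxE0 F a).
Local Notation T1 := (mxtilde A1).
Local Notation T2 := (mxtilde A2).
Local Notation X := (mu A1 A2 D8x).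
Local Notation Z := (@sigma F a (D8x ^+ 2)%g).
Local Notation Y := (@sigma F a D8y).
Local Notation smon := (mono X Z Y).
Local Notation A := (adjacency_algebra (schemeD A1 A2)).

Let j0 : 'I_a := Ordinal a_gt0.
Let aR0 : a%:R != 0 :> F.
Proof. by rewrite pnatr_eq0 -lt0n. Qed.

Section Intertwiner.
Variables (k : nat) (P : 'M[F]_(k, N)) (Q : 'M[F]_(N, k)) (BX BZ BY : 'M[F]_k).
Hypothesis PQ : P *m Q = 1%:M.
Hypotheses (PX : P *m X = BX *m P) (PZ : P *m Z = BZ *m P) (PY : P *m Y = BY *m P).

Lemma intertwine_repr : alg_repr A (subrep P Q).
Proof.
apply: alg_repr_subrep => // M /schemeDP[s [i [j ->]]].
by exists (mono BX BZ BY s i j); apply: mono_intertwine.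
Qed.

Lemma intertwine_smon s i j : subrep P Q (smon s i j) = mono BX BZ BY s i j.
Proof. by apply: subrep_intertwine => //; apply: mono_intertwine. Qed.

Lemma intertwine_smon2 s i j (B := mono BX BZ BY s i j) :
  subrep P Q (smon s i j *m smon s i j) = B *m B.
Proof.
have e : P *m smon s i j = B *m P by apply: mono_intertwine.
by apply: subrep_intertwine => //; rewrite mulmxA e -mulmxA e mulmxA.
Qed.
End Intertwiner.

Lemma row_mul_E (u : F) (w : 'rV_a) :
  row_mx (u%:M : 'M_1) w *m E = row_mx (\sum_j w 0 j)%:M (const_mx u).
Proof.
rewrite mul_row_block !mulmx0 add0r addr0; congr row_mx; apply/rowP=> j.
  by rewrite ord1 !mxE mulr1n; apply: eq_bigr => l _; rewrite mxE mulr1.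
by rewrite mul_scalar_mx !mxE mulr1.
Qed.

Lemma row_mul_T (u c : F) (B : 'M_a) : const_mx 1 *m B = const_mx kappa :> 'rV_a ->
  row_mx (u%:M : 'M_1) (const_mx c) *m mxtilde B = row_mx 0 (const_mx (c * kappa)).
Proof.
move=> hB; rewrite mul_row_block !mulmx0 !add0r; congr row_mx.
have -> : const_mx c = c *: const_mx 1 :> 'rV_a.
  by apply/rowP=> j; rewrite !mxE mulr1.
by rewrite -scalemxAl hB; apply/rowP=> j; rewrite !mxE.
Qed.

Lemma row_mul_X (v : 'rV_(1 + a)) (s : 'rV_4) :
  row_tens v s *m X = row_tens (v *m E) (s *m perm_mx (D8x * zy false false)%g)
    + row_tens (v *m T1) (s *m perm_mx (D8x * zy false true)%g)
    + row_tens (v *m T2) (s *m perm_mx (D8x * zy true true)%g).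
Proof. by rewrite mu_x !mulmxDr !row_tens_mul. Qed.

Let sum_const1 : \sum_j (const_mx 1 : 'rV[F]_a) 0 j = a%:R.
Proof. by under eq_bigr do rewrite mxE; rewrite sumr_const card_ord. Qed.

(* The common eigenvectors of X, Z, Y on which Z acts trivially; eps is the
   eigenvalue of Y and lam that of X, so that (lam, c) is (a, 1) or (-1, -a). *)
Section Linear.
Variables (eps c lam : F).
Hypotheses (eps2 : eps * eps = 1) (lamc : lam * c = a%:R) (cE : c + a%:R - 1 = lam).

Definition lin_row : 'rV[F]_N :=
  row_tens (row_mx ((eps * c)%:M : 'M_1) (const_mx 1))
    (\row_(j < 4) nth 0 [:: 1; eps; 1; eps] j).

Lemma lin_row_free : lin_row *m pinvmx lin_row = 1%:M.
Proof.
have lin_row0 : lin_row != 0; last by rewrite mulmxVp // /row_free rank_rV lin_row0.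
apply: contraTneq isT => /rowP /(_ (mxtens_index (rshift 1 j0, ord0))).
rewrite row_tensE row_mxEr !mxE /= mulr1 => /eqP.
by rewrite oner_eq0.
Qed.

Lemma lin_rowX : lin_row *m X = lam%:M *m lin_row.
Proof.
have [h1 h2 h3] := row4_xzy (1 : F) eps 1 eps.
rewrite /lin_row row_mul_X h1 h2 h3 row_mul_E sum_const1.
rewrite !row_mul_T ?(JA1 colsum) ?(JA2 A2E rowsum) //.
(* The shifted row is [eps] times the original one, so all three terms share the same right
   factor. *)
have -> : [:: eps; 1; eps; 1] = [:: eps * 1; eps * eps; eps * 1; eps * eps].
  by rewrite mulr1 eps2.
rewrite row4_scale row_tensZr -row_tensZl -!row_tensDl mul_scalar_mx -row_tensZl.
congr row_tens; rewrite !scale_row_mx !add_row_mx !addr0.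
(* The corner entry amounts to [lam * c = a], the other entries to [c + 2 * kappa = lam]. *)
congr row_mx; apply/rowP=> j; rewrite !mxE ?ord1 ?mulr1n.
  by rewrite -lamc; ring.
by rewrite mulrA eps2 -cE aE; ring.
Qed.

Lemma lin_rowZ : lin_row *m Z = 1%:M *m lin_row.
Proof. by rewrite /lin_row /sigma row_tens_mul mulmx1 row4_z mul1mx. Qed.

Lemma lin_rowY : lin_row *m Y = eps%:M *m lin_row.
Proof.
rewrite /lin_row /sigma row_tens_mul mulmx1 row4_D8y mul_scalar_mx -row_tensZr.
by rewrite -row4_scale mulr1 eps2.
Qed.

Definition lin_char (M : 'M[F]_N) : F := \tr (subrep lin_row (pinvmx lin_row) M).

Lemma lin_char_smon s i j :
  lin_char (smon s i j) = (if s then lam else 1) * (if j then eps else 1).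
Proof.
rewrite /lin_char (intertwine_smon lin_row_free lin_rowX lin_rowZ lin_rowY).
by rewrite mono_scalar mxtrace_scalar mulr1n; case: i; rewrite mul1r.
Qed.

Lemma lin_char_smon2 s i j :
  lin_char (smon s i j *m smon s i j) = (if s then lam * lam else 1).
Proof.
rewrite /lin_char (intertwine_smon2 lin_row_free lin_rowX lin_rowZ lin_rowY).
rewrite mono_scalar -scalar_mxM mxtrace_scalar mulr1n.
by case: s i j => [] [] []; rewrite !(mul1r, mulr1) // mulrACA eps2 mulr1.
Qed.

Lemma lin_repr : alg_repr A (subrep lin_row (pinvmx lin_row)).
Proof. exact: intertwine_repr lin_row_free lin_rowX lin_rowZ lin_rowY. Qed.

Lemma lin_irr : irr_character (schemeD A1 A2) lin_char.
Proof.
exists 1%N, (subrep lin_row (pinvmx lin_row)); split=> //; first exact: lin_repr.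
apply: alg_irreducible_delta => // i j; exists 1%:M.
  by have := mem_smon A1 A2 false false false; rewrite /mono /= !mul1mx.
by case: lin_repr => _ -> _; apply/matrixP=> r t; rewrite !mxE !ord1.
Qed.
End Linear.

(** [plane_p] and [plane_q] span the rows negated by x^2: y fixes p and negates q, and x sends p to
    q and q to -p. *)
Definition plane_p : 'rV[F]_4 := \row_j nth 0 [:: 1; 1; -1; -1] j.
Definition plane_q : 'rV[F]_4 := \row_j nth 0 [:: -1; 1; 1; -1] j.
Definition plane_row0 : 'rV[F]_(1 + a) := row_mx (1%:M : 'M_1) (const_mx 0).
Definition plane_row1 : 'rV[F]_(1 + a) := row_mx (0%:M : 'M_1) (const_mx 1).

Definition plane_P : 'M[F]_(2, N) :=
  \matrix_(i < 2) (if i == 0 then row_tens plane_row0 plane_p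
                   else row_tens plane_row1 plane_q).

Definition plane_X : 'M[F]_2 := mx_of_rows 2 [:: [:: 0; 1]; [:: - a%:R; 0]].
Definition plane_Y : 'M[F]_2 := mx_of_rows 2 [:: [:: 1; 0]; [:: 0; -1]].

Lemma row_plane (B : 'M_2) i :
  row i (B *m plane_P) =
  B i 0 *: row_tens plane_row0 plane_p + B i 1 *: row_tens plane_row1 plane_q.
Proof.
rewrite row_mul mulmx_sum_row !big_ord_recl big_ord0 addr0 !rowK !mxE /=.
by congr (_ + B i _ *: _); apply: val_inj.
Qed.

Lemma plane_eq (M : 'M_N) (B : 'M_2) :
    row_tens plane_row0 plane_p *m M =
      B 0 0 *: row_tens plane_row0 plane_p + B 0 1 *: row_tens plane_row1 plane_q ->
    row_tens plane_row1 plane_q *m M =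
      B 1 0 *: row_tens plane_row0 plane_p + B 1 1 *: row_tens plane_row1 plane_q ->
  plane_P *m M = B *m plane_P.
Proof.
move=> h0 h1; apply/row_matrixP=> i; rewrite row_plane row_mul rowK.
case: i => [[|[|]]] //= i2.
  by rewrite h0; congr (B _ _ *: _ + B _ _ *: _); apply: val_inj.
by rewrite h1; congr (B _ _ *: _ + B _ _ *: _); apply: val_inj.
Qed.

Lemma plane_PX : plane_P *m X = plane_X *m plane_P.
Proof.
apply: plane_eq; rewrite row_mul_X !mxE /= ?scale0r ?scale1r ?addr0 ?add0r.
  have [-> -> ->] := row4_xzy (1 : F) 1 (-1) (-1).
  rewrite row_mul_E !row_mul_T ?(JA1 colsum) ?(JA2 A2E rowsum) // !mul0r.
  rewrite big1 => [|j _]; last by rewrite mxE.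
  have -> : row_mx (0 : 'M_1) (const_mx 0) = 0 :> 'rV[F]_(1 + a).
    by rewrite -[RHS]row_mx0; congr row_mx; apply/rowP=> j; rewrite !mxE.
  by rewrite !row_tens0 !addr0.
have [-> -> ->] := row4_xzy (-1 : F) 1 1 (-1).
rewrite row_mul_E !row_mul_T ?(JA1 colsum) ?(JA2 A2E rowsum) // sum_const1 mul1r.
have -> : \row_(j < 4) nth 0 [:: -1; -1; 1; 1] j = -1 *: plane_p.
  by rewrite -row4_scale !mulN1r opprK.
(* The permutations attached to [T1] and [T2] send q to -p and to p, so these two contributions
   cancel. *)
rewrite -/plane_p !row_tensZr !scaleN1r addrNK -scaleN1r -!row_tensZl; congr row_tens.
rewrite /plane_row0 !scale_row_mx; congr row_mx; apply/rowP=> j; rewrite !mxE ?mulr0 ?ord1 //.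
by rewrite mulN1r mulr1.
Qed.

Lemma plane_PZ : plane_P *m Z = - 1%:M *m plane_P.
Proof.
apply: plane_eq; rewrite /sigma row_tens_mul mulmx1 row4_z !mxE /=.
  rewrite oppr0 scale0r addr0 -row_tensZr -row4_scale.
  by rewrite !mulN1r !opprK.
rewrite oppr0 scale0r add0r -row_tensZr -row4_scale.
by rewrite !mulN1r !opprK.
Qed.

Lemma plane_PY : plane_P *m Y = plane_Y *m plane_P.
Proof.
apply: plane_eq; rewrite /sigma row_tens_mul mulmx1 row4_D8y !mxE /=.
  by rewrite scale1r scale0r addr0.
rewrite scale0r add0r -row_tensZr -row4_scale.
by rewrite !mulN1r !opprK.
Qed.

Lemma plane_free : plane_P *m pinvmx plane_P = 1%:M.
Proof.
apply: mulmxVp; apply/row_freeP.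
(* Two columns on which [plane_P] restricts to the identity; the second uses point 1, where q has
   entry 1. *)
pose f (j : 'I_2) : 'I_N :=
  if j == 0 then mxtens_index (lshift a ord0, ord0)
  else mxtens_index (rshift 1 j0, inord 1).
exists (colsub f 1%:M); rewrite mulmx_colsub mulmx1.
apply/matrixP=> i j; rewrite /f !mxE.
case: i j => [[|[|]]] //= ? [[|[|]]] //= ?;
  rewrite row_tensE /= ?row_mxEl ?row_mxEr !mxE /= ?inordK //.
all: by rewrite ?mul0r ?mulr0 ?mulr1.
Qed.

Definition plane_rho := subrep plane_P (pinvmx plane_P).
Definition plane_char (M : 'M[F]_N) : F := \tr (plane_rho M).

Lemma plane_repr : alg_repr A plane_rho.
Proof. exact: intertwine_repr plane_free plane_PX plane_PZ plane_PY. Qed.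

Lemma plane_rho_smon s i j : plane_rho (smon s i j) = mono plane_X (- 1%:M) plane_Y s i j.
Proof. exact: intertwine_smon plane_free plane_PX plane_PZ plane_PY _ _ _. Qed.

Let mx2P (M P : 'M[F]_2) : M 0 0 = P 0 0 -> M 0 1 = P 0 1 ->
  M 1 0 = P 1 0 -> M 1 1 = P 1 1 -> M = P.
Proof.
move=> h00 h01 h10 h11; apply/matrixP.
have o0 (i : 'I_2) : i = 0 \/ i = 1.
  by case: i => [[|[|]]] // ?; [left | right]; apply: val_inj.
by move=> i j; case: (o0 i) => ->; case: (o0 j) => ->.
Qed.

Lemma plane_YX : plane_Y *m plane_X = - (plane_X *m plane_Y).
Proof.
by apply: mx2P; rewrite !mxE !big_ord_recl !big_ord0 !mxE /=; ring.
Qed.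

Lemma plane_XX : plane_X *m plane_X = - a%:R%:M.
Proof.
by apply: mx2P; rewrite !mxE !big_ord_recl !big_ord0 !mxE /=; ring.
Qed.

Lemma plane_YY : plane_Y *m plane_Y = 1%:M.
Proof.
by apply: mx2P; rewrite !mxE !big_ord_recl !big_ord0 !mxE /=; ring.
Qed.

Let tr2 (M : 'M[F]_2) : \tr M = M 0 0 + M 1 1.
Proof.
rewrite /mxtrace !big_ord_recl big_ord0 addr0.
by congr (_ + M _ _); apply: val_inj.
Qed.

Lemma plane_trX : \tr plane_X = 0.
Proof. by rewrite tr2 !mxE /= addr0. Qed.

Lemma plane_trY : \tr plane_Y = 0.
Proof. by rewrite tr2 !mxE /= subrr. Qed.

Lemma plane_trXY : \tr (plane_X *m plane_Y) = 0.
Proof. by rewrite tr2 !mxE !big_ord_recl !big_ord0 !mxE /=; ring. Qed.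

Lemma plane_char_smon s i j :
  plane_char (smon s i j) = if s || j then 0 else (-1) ^+ i *+ 2.
Proof.
by rewrite /plane_char plane_rho_smon mono_trace // ?plane_trX ?plane_trY ?plane_trXY.
Qed.

Lemma plane_char_smon2 s i j :
  plane_char (smon s i j *m smon s i j) =
  (if s then (if j then a%:R else - a%:R) else 1) *+ 2.
Proof.
rewrite /plane_char /plane_rho (intertwine_smon2 plane_free plane_PX plane_PZ plane_PY).
by rewrite (mono_sq_trace _ plane_YY plane_XX plane_YX).
Qed.

Lemma plane_irr : irr_character (schemeD A1 A2) plane_char.
Proof.
exists 2%N, plane_rho; split=> //; first exact: plane_repr.
have rE c d s i j s' i' j' :
    plane_rho (c *: (smon s i j + d *: smon s' i' j')) =
    c *: (mono plane_X (- 1%:M) plane_Y s i j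
          + d *: mono plane_X (- 1%:M) plane_Y s' i' j').
  rewrite -!plane_rho_smon /plane_rho /subrep.
  by rewrite -scalemxAr mulmxDr -scalemxAr -scalemxAl mulmxDl -scalemxAl.
have mem c d s i j s' i' j' : c *: (smon s i j + d *: smon s' i' j') \in A.
  by apply: memvZ; apply: memvD; rewrite ?memvZ ?mem_smon.
apply: alg_irreducible_delta => // i j.
have two : 2 != 0 :> F by rewrite pnatr_eq0.
(* The diagonal units are (1 + Y)/2 and (1 - Y)/2. The others come from X - X Y = 2 E_01 and X + X Y
   = - 2 a E_10, the minus sign in the first being supplied by Z = -1. *)
pose c : F := if (i == 1) && (j == 0) then - (2 * a%:R)^-1 else 2^-1.
pose d : F := if i == 1 then -1 else 1.
pose s := i != j.
exists (c *: (smon s false false + d *: smon s s true)); first exact: mem.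
rewrite rE {}/c {}/d {}/s /mono; apply: mx2P;
  case: i j => [[|[|]]] //= ? [[|[|]]] //= ?;
  rewrite ?mulmx1 ?mul1mx ?mulNmx ?mulmxN ?mul1mx !mxE ?big_ord_recl ?big_ord0 ?mxE /=;
  by field; rewrite ?aR0 ?two.
Qed.

(** * Entries and valencies of the matrices of D *)

Lemma valencyE (M : 'M[F]_N) (r : nat) : (forall i j, M i j \in [:: 0; 1]) ->
  (forall i, \sum_j M i j = r%:R) -> valency M = r.
Proof.
move=> M01 Mr; rewrite /valency.
(* The index type is nonempty, so the default valency 0 does not occur. *)
case: pickP => [i _|/(_ (mxtens_index (lshift a ord0, ord0)))//].
apply/eqP; rewrite -(eqr_nat F) -(Mr i) -sum1_card natr_sum big_mkcond /=.
apply/eqP; apply: eq_bigr => j _; rewrite inE.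
have := M01 i j; rewrite !inE => /orP[] /eqP ->; last by rewrite eqxx.
by rewrite eq_sym oner_eq0.
Qed.

Hypothesis A01 : forall i j, A1 i j \in [:: 0; 1].
Hypothesis skew : forall i j, A1 i j * A1 j i = 0.

Lemma perm_mx01 (s : 'S_4) i j : (perm_mx s : 'M[F]_4) i j \in [:: 0; 1].
Proof. by rewrite !mxE !inE; case: (_ == j); rewrite ?eqxx ?orbT. Qed.

(** The supports are disjoint, inside the lower block by the tournament property, so every 4 by 4
    block of a [mu] is zero or a permutation matrix. *)
Lemma ET_entries i j : (E i j, T1 i j, T2 i j) \in
  [:: (0, 0, 0); (1, 0, 0); (0, 1, 0); (0, 0, 1)].
Proof.
rewrite -(splitK i) -(splitK j); case: (split i) => {}i; case: (split j) => {}j /=;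
  rewrite /mxE0 /mxtilde ?(block_mxEul, block_mxEur, block_mxEdl, block_mxEdr) !mxE.
- by rewrite !inE eqxx.
- by rewrite !inE eqxx !orbT.
- by rewrite !inE eqxx !orbT.
rewrite A2E mxE; have := skew i j; have := A01 i j; have := A01 j i.
rewrite !inE => /orP[] /eqP -> /orP[] /eqP ->; rewrite ?eqxx ?orbT // mulr1.
by move/eqP; rewrite oner_eq0.
Qed.

Lemma smon01 s i j r c : smon s i j r c \in [:: 0; 1].
Proof.
case: (mxtens_indexP r) => {}r r'; case: (mxtens_indexP c) => {}c c'.
case: s; last first.
  rewrite smon0 /sigma tensmxE mxE; have := perm_mx01 (zy i j) r' c'.
  by case: (r == c); rewrite ?mul1r // mul0r !inE eqxx.
rewrite smon1 mu_zy mxE [X in X + _]mxE !tensmxE.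
have := ET_entries r c; rewrite 4!in_cons in_nil orbF => /or4P[] /eqP[-> -> ->];
  by rewrite !(mul0r, mul1r, add0r, addr0) ?perm_mx01 // !inE eqxx.
Qed.

Lemma valency_smon s i j : valency (smon s i j) = if s then a else 1%N.
Proof.
apply: valencyE => [r c|r]; first exact: smon01.
have rowE (M : 'M[F]_N) :
    \sum_c M r c = (M *m (const_mx 1 *t const_mx 1 : 'M_(_, 1 * 1))) r 0.
  by rewrite !mxE; apply: eq_bigr => c _; rewrite !mxE !mulr1.
have permJ (g : 'S_4) : perm_mx g *m const_mx 1 = const_mx 1 :> 'cV[F]_4.
  by rewrite -row_permE; apply/matrixP=> x y; rewrite !mxE.
rewrite rowE; case: s; last first.
  by rewrite smon0 /sigma tensmx_mul mul1mx permJ !mxE mulr1.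
rewrite smon1 mu_zy !mulmxDl !tensmx_mul !permJ -!tensmxDl -!mulmxDl.
(* The top row sums to a, each other row to 1 + 2 kappa = a. *)
have -> : (E + T1 + T2) *m const_mx 1 = const_mx a%:R :> 'cV_(1 + a).
  rewrite /mxE0 /mxtilde !add_block_mx !(addr0, add0r).
  have -> : const_mx 1 = col_mx (const_mx 1) (const_mx 1) :> 'cV[F]_(1 + a).
    by rewrite col_mx_const.
  rewrite mul_block_col.
  rewrite mul0mx add0r mulmxDl (A1J rowsum) (A2J A2E colsum) -[RHS]col_mx_const.
  congr col_mx; apply/matrixP=> x y; rewrite !mxE.
    by under eq_bigr do rewrite !mxE mulr1; rewrite sumr_const card_ord.
  by rewrite big_ord1 !mxE mulr1 aE; ring.
by rewrite !mxE mulr1.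
Qed.

(** The squares do not involve the exponent of the central involution Z, hence the factors 2. *)
Lemma FS_schemeD chi m (u : bool -> bool -> F) :
    (forall s i j, chi (smon s i j *m smon s i j) = u s j) ->
  FS_indicator (schemeD A1 A2) chi m =
  m%:R / (N%:R * chi 1%:M) *
    (2 * (u false false + u false true) + 2 * (u true false + u true true) / a%:R).
Proof.
move=> chi2; rewrite /FS_indicator big_schemeD; congr (_ * _).
under eq_bigr do under eq_bigr do under eq_bigr do rewrite valency_smon chi2.
by rewrite !big_bool /= !invr1; ring.
Qed.

Definition D_char (i : 'I_5) : 'M[F]_N -> F :=
  nth plane_char [:: lin_char 1 1; lin_char (-1) 1;
                     lin_char 1 (- a%:R); lin_char (-1) (- a%:R)] i.

(** As in [D_char], the default value of [nth] is the fifth entry. *)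
Definition D_mult (i : 'I_5) : nat := nth a.+1 [:: 1; 1; a; a]%N i.

(* D_val i s p q is the value of the i-th character at X^s Z^p Y^q, and D_val2
   below its value at the square, which does not depend on p. *)
Definition D_val (i : nat) (s p q : bool) : F :=
  nth (if s || q then 0 else (-1) ^+ p *+ 2)
    [:: (if s then a%:R else 1) * (if q then 1 else 1);
        (if s then a%:R else 1) * (if q then -1 else 1);
        (if s then -1 else 1) * (if q then 1 else 1);
        (if s then -1 else 1) * (if q then -1 else 1)] i.

Let lamc1 : a%:R * 1 = a%:R :> F. Proof. exact: mulr1. Qed.
Let lamca : -1 * - a%:R = a%:R :> F. Proof. by rewrite mulN1r opprK. Qed.
Let cE1 : 1 + a%:R - 1 = a%:R :> F. Proof. by rewrite addrC addrA addNr add0r. Qed.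
Let cEa : - a%:R + a%:R - 1 = -1 :> F. Proof. by rewrite addNr add0r. Qed.
Let sq1 : 1 * 1 = 1 :> F. Proof. exact: mulr1. Qed.
Let sqN1 : -1 * -1 = 1 :> F. Proof. by rewrite mulN1r opprK. Qed.

Lemma D_char_smon i s p q : D_char i (smon s p q) = D_val i s p q.
Proof.
case: i => [[|[|[|[|[|]]]]]] //= ?; rewrite /D_char /D_val /=.
- exact: lin_char_smon.
- exact: lin_char_smon.
- exact: lin_char_smon.
- exact: lin_char_smon.
- exact: plane_char_smon.
Qed.

Lemma D_char_irr i : irr_character (schemeD A1 A2) (D_char i).
Proof.
case: i => [[|[|[|[|[|]]]]]] //= ?; rewrite /D_char /=.
- exact: lin_irr sq1 lamc1 cE1.
- exact: lin_irr sqN1 lamc1 cE1.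
- exact: lin_irr sq1 lamca cEa.
- exact: lin_irr sqN1 lamca cEa.
- exact: plane_irr.
Qed.

Lemma D_char_lin i c :
  {in A &, forall M P, D_char i (c *: M + P) = c * D_char i M + D_char i P}.
Proof.
move=> M P AM AP; have [k [rho [[lin _ _] _ chiE]]] := D_char_irr i.
by rewrite !chiE ?memvD ?memvZ // lin // mxtraceD mxtraceZ.
Qed.

Lemma D_char0 i : D_char i 0 = 0.
Proof.
have := D_char_lin i (-1) (mem0v _) (mem0v _).
by rewrite scaler0 addr0 mulN1r addNr.
Qed.

Lemma mxtrace_zy p q : \tr (perm_mx (zy p q) : 'M[F]_4) = if p || q then 0 else 4.
Proof.
rewrite /mxtrace !big_ord_recl big_ord0 !mxE -!val_eqE zyE /=.
move: D8x D8y val_D8x val_D8y => x y vx vy.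
case: p q => [] []; rewrite !(expg0, expg1) !permM ?perm1 /= ?(vx, vy) /=; ring.
Qed.

Lemma mxtrace_smon s p q :
  \tr (smon s p q) = if [|| s, p | q] then 0 else 4 * (1 + a%:R).
Proof.
case: s => /=; last first.
  rewrite smon0 /sigma mxtrace_tens mxtrace1 mxtrace_zy natrD.
  by case: (p || q); rewrite ?mulr0 // mulrC.
have A1d i : A1 i i = 0.
  by have /eqP := skew i i; rewrite mulf_eq0 orbb => /eqP.
rewrite smon1 mu_zy !mxtraceD !mxtrace_tens /mxE0 /mxtilde !mxtrace_block !mxtrace0.
rewrite A2E mxtrace_tr /(\tr A1) big1 => [|i _]; last exact: A1d.
by rewrite !addr0 !mul0r !addr0.
Qed.

Lemma D_mult_ok : multiplicities (schemeD A1 A2) D_char D_mult.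
Proof.
apply: smon_ind => [|c M P AM AP hM hP|s p q].
- by rewrite mxtrace0 big1 // => i _; rewrite D_char0 mulr0.
- rewrite mxtraceD mxtraceZ hM hP mulr_sumr -big_split /=; apply: eq_bigr => i _.
  by rewrite D_char_lin //; ring.
rewrite mxtrace_smon !big_ord_recl big_ord0 !D_char_smon /D_val /D_mult /=.
rewrite -natr1; case: s p q => [] [] [] /=; rewrite ?expr0 ?expr1; ring.
Qed.

Definition D_val2 (i : nat) (s q : bool) : F :=
  nth ((if s then (if q then a%:R else - a%:R) else 1) *+ 2)
    [:: if s then a%:R * a%:R else 1; if s then a%:R * a%:R else 1;
        if s then -1 * -1 else 1; if s then -1 * -1 else 1] i.

Lemma D_char_smon2 i s p q : D_char i (smon s p q *m smon s p q) = D_val2 i s q.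
Proof.
case: i => [[|[|[|[|[|]]]]]] //= ?; rewrite /D_char /D_val2 /=.
- exact: lin_char_smon2.
- exact: lin_char_smon2.
- exact: lin_char_smon2.
- exact: lin_char_smon2.
- exact: plane_char_smon2.
Qed.

Lemma D_FS i : FS_indicator (schemeD A1 A2) (D_char i) (D_mult i) = 1.
Proof.
have one : 1%:M = smon false false false by rewrite /mono /= !mul1mx.
have a1 : 1 + a%:R != 0 :> F by rewrite nat1r pnatr_eq0.
have two : 2 != 0 :> F by rewrite pnatr_eq0.
have four : 4 != 0 :> F by rewrite pnatr_eq0.
rewrite (FS_schemeD _ (D_char_smon2 i)) one D_char_smon natrM natrD.
case: i => [[|[|[|[|[|]]]]]] //= ?; rewrite /D_val /D_val2 /D_mult /= -?nat1r ?expr0;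
  by field; rewrite ?aR0 ?a1 ?two ?four.
Qed.

Lemma D_char_inj i j : {in A, D_char i =1 D_char j} -> i = j.
Proof.
move=> eq_ij; have eq_val s p q : D_val i s p q = D_val j s p q.
  by rewrite -!D_char_smon eq_ij // mem_smon.
(* The index is recovered from the values: the degree isolates the fifth character, and the values
   -1 at Y and at X are the binary digits of the other indices. *)
pose code l := if D_val l false false false == 1 then
  ((D_val l false false true == -1)%R + (D_val l true false false == -1)%R * 2)%N else 4%N.
have eN1 : (1 == -1 :> F) = false by rewrite -addr_eq0 -mulr2n pnatr_eq0.
have aN1 : (a%:R == -1 :> F) = false by rewrite -addr_eq0 natr1 pnatr_eq0.
have codeE (l : 'I_5) : code l = l.
  case: l => [[|[|[|[|[|]]]]]] //= ?; rewrite /code /D_val /= ?mulr1 ?mul1r ?eqxx ?eN1 ?aN1 //.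
  by rewrite expr0 pnatr_eq1.
by apply: val_inj; rewrite /= -(codeE i) -(codeE j) /code !eq_val.
Qed.

(** * Completeness of the list of characters *)

Lemma D_relations : [/\ Z *m Z = 1%:M, Y *m Y = 1%:M, Z *m X = X *m Z,
  Z *m Y = Y *m Z & Y *m X = X *m (Z *m Y)].
Proof.
split; rewrite ?sigmaM ?D8zz ?D8yy ?sigma1 ?D8zy //.
  by rewrite -zy10 sigma_mu.
by rewrite -D8zy -zy01 sigma_mu /= -zy10 zyM.
Qed.

Lemma D_char_complete phi :
  irr_character (schemeD A1 A2) phi -> exists i, {in A, phi =1 D_char i}.
Proof.
move=> [k [rho [rep [k0 irr] phiE]]].
have [lin rho1 rhoM] := rep.
have mX : X \in A by have := mem_smon A1 A2 true false false; rewrite /mono /= !mulmx1.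
have mZ : Z \in A by have := mem_smon A1 A2 false true false; rewrite /mono /= !mulmx1 mul1mx.
have mY : Y \in A by have := mem_smon A1 A2 false false true; rewrite /mono /= !mul1mx.
have mXZ : X *m Z \in A by have := mem_smon A1 A2 true true false; rewrite /mono /= mulmx1.
have mZY : Z *m Y \in A by have := mem_smon A1 A2 false true true; rewrite /mono /= mul1mx.
have rho0 : rho 0 = 0.
  have := lin (-1) 0 0 (mem0v _) (mem0v _).
  by rewrite scaler0 addr0 scaleN1r addNr.
have rhoZ c M : M \in A -> rho (c *: M) = c *: rho M.
  by move=> AM; rewrite -[c *: M]addr0 lin ?mem0v // rho0 addr0.
have rhoD M P : M \in A -> P \in A -> rho (M + P) = rho M + rho P.
  by move=> AM AP; rewrite -[M in LHS]scale1r lin // scale1r.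
have [ZZ YY ZX ZY YX] := D_relations.
have rZZ : rho Z *m rho Z = 1%:M by rewrite -rhoM // ZZ.
have rYY : rho Y *m rho Y = 1%:M by rewrite -rhoM // YY.
have rZX : rho Z *m rho X = rho X *m rho Z by rewrite -!rhoM // ZX.
have rZY : rho Z *m rho Y = rho Y *m rho Z by rewrite -!rhoM // ZY.
have rYX : rho Y *m rho X = rho X *m rho Z *m rho Y.
  by rewrite -mulmxA -!rhoM // YX.
have rXX : rho X *m rho X = a%:R *: rho Z + kappa *: (rho X + rho X *m rho Z).
  have mXXZ : X + X *m Z \in A by exact: memvD.
  by rewrite -!rhoM // (muXX aE A2E sumA rowsum colsum sqA) rhoD ?memvZ // !rhoZ // rhoD.
(* Stability under the three generators passes to monomials and to their span, so irreducibility can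
   be tested on the generators alone. *)
have irr3 (U : 'M[F]_k) :
    {in [:: rho X; rho Z; rho Y], forall B, stablemx U B} -> U != 0 -> row_full U.
  move=> stU; apply: irr; apply: smon_ind => [|c M P AM AP sM sP|s p q].
  - by rewrite rho0 mulmx0 sub0mx.
  - by rewrite lin // mulmxDr -scalemxAr addmx_sub ?scalemx_sub.
  have stM B C : stablemx U B -> stablemx U C -> stablemx U (B *m C).
    by move=> sB sC; rewrite mulmxA; apply: submx_trans (submxMr _ sB) sC.
  have stc b B : B \in [:: rho X; rho Z; rho Y] -> stablemx U (cnd b B).
    by case: b => [/stU//|_]; rewrite /= mulmx1.
  rewrite repr_smon //; apply: (stM); last apply: (stM); apply: stc;
    by rewrite !inE eqxx ?orbT.
have [Z1|Z1] := irr_cases rZZ rZX rZY irr3.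
  have [eta eta1 [xi xi1 [k1 [Ye Xe]]]] := irr_case1 aE rYY rZX rZY rYX rXX k0 irr3 Z1.
  (* The characters agree once the scalars by which X and Y act agree; the parameter c is 1 for X =
     a and -a for X = -1. *)
  have lin_case e c l (e2 : e * e = 1) (lc : l * c = a%:R) (cE : c + a%:R - 1 = l) :
      rho Y = e%:M -> rho X = l%:M -> {in A, phi =1 lin_char e c}.
    move=> Ye' Xe' M AM; rewrite phiE //.
    apply: (repr_trace_eq rep (lin_repr e2 lc cE)) => // s p q.
    rewrite -/(lin_char e c _) (lin_char_smon e2 lc cE) repr_smon // Xe' Ye' Z1.
    rewrite mono_scalar mxtrace_scalar k1 mulr1n.
    by case: p; rewrite mul1r.
  move: eta1 xi1 Ye Xe; rewrite !inE.
  case/orP=> /eqP-> /orP[] /eqP-> Ye Xe.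
  - by exists (inord 0); rewrite /D_char inordK //; apply: lin_case Ye Xe.
  - by exists (inord 2); rewrite /D_char inordK //; apply: lin_case Ye Xe.
  - by exists (inord 1); rewrite /D_char inordK //; apply: lin_case Ye Xe.
  - by exists (inord 3); rewrite /D_char inordK //; apply: lin_case Ye Xe.
have [k2 trX trY trXY] := irr_caseN1 aR0 rYY rYX rXX k0 irr3 Z1.
exists (inord 4); rewrite /D_char inordK //= => M AM; rewrite phiE //.
apply: (repr_trace_eq rep plane_repr) => // s p q.
by rewrite -/(plane_char _) plane_char_smon repr_smon // Z1 mono_trace.
Qed.

Lemma D_enumerates : enumerates_irr (schemeD A1 A2) D_char.
Proof.
by split; [exact: D_char_irr | exact: D_char_inj | exact: D_char_complete].
Qed.

Lemma D_table :
  [seq [seq D_char i M | M <-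
            [:: sigma 1%g; Z; Y; sigma (D8x ^+ 2 * D8y)%g;
                X; mu A1 A2 (D8x ^+ 3)%g;
                mu A1 A2 (D8x * D8y)%g; mu A1 A2 (D8x ^+ 3 * D8y)%g]]
          | i : 'I_5]
        = [:: [:: 1;  1;  1;  1; a%:R; a%:R;   a%:R;   a%:R];
              [:: 1;  1; -1; -1; a%:R; a%:R; - a%:R; - a%:R];
              [:: 1;  1;  1;  1;   -1;   -1;     -1;     -1];
              [:: 1;  1; -1; -1;   -1;   -1;      1;      1];
              [:: 2; -2;  0;  0;    0;    0;      0;      0]].
Proof.
have -> : [:: sigma 1%g; Z; Y; sigma (D8x ^+ 2 * D8y)%g;
                X; mu A1 A2 (D8x ^+ 3)%g;
                mu A1 A2 (D8x * D8y)%g; mu A1 A2 (D8x ^+ 3 * D8y)%g] =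
  [:: smon false false false; smon false true false; smon false false true;
      smon false true true;
      smon true false false; smon true true false; smon true false true;
      smon true true true].
  have zy11 : zy true true = (D8x ^+ 2 * D8y)%g by rewrite zyE !expg1.
  have x3 : (D8x ^+ 3 = D8x * D8x ^+ 2)%g by rewrite expgS.
  rewrite !smon0 !smon1 zy00 zy10 zy01 zy11 mulg1 x3.
  by rewrite -[(D8x * D8x ^+ 2 * D8y)%g]mulgA.
rewrite /image_mem !enum_ordSl enum_ord0 /= !D_char_smon /D_val /=.
by rewrite !(mulr1, mul1r, mulrN1, mulN1r, opprK, expr0, expr1) mulNrn.
Qed.
End Characters.

Theorem proposition4p1 (R : realType) (a n : nat) (A1 A2 : 'M[R[i]]_a)
    (hn : n = a.+1)
    (hA2 : A2 = A1^T)
    (hA : assoc_scheme [:: 1%:M; A1; A2])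
    (hns : ~ symmetric_scheme [:: 1%:M; A1; A2]) :
  exists (chi : 'I_5 -> 'M[R[i]]_((1 + a) * 4) -> R[i]) (m : 'I_5 -> nat),
    [/\ enumerates_irr (schemeD A1 A2) chi,
        multiplicities (schemeD A1 A2) chi m,
        [seq [seq chi i M | M <-
            [:: sigma 1%g; sigma (D8x ^+ 2)%g;
                sigma D8y; sigma (D8x ^+ 2 * D8y)%g;
                mu A1 A2 D8x; mu A1 A2 (D8x ^+ 3)%g;
                mu A1 A2 (D8x * D8y)%g; mu A1 A2 (D8x ^+ 3 * D8y)%g]]
          | i : 'I_5]
        = [:: [:: 1;  1;  1;  1; a%:R; a%:R;   a%:R;   a%:R];
              [:: 1;  1; -1; -1; a%:R; a%:R; - a%:R; - a%:R];
              [:: 1;  1;  1;  1;   -1;   -1;     -1;     -1];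
              [:: 1;  1; -1; -1;   -1;   -1;      1;      1];
              [:: 2; -2;  0;  0;    0;    0;      0;      0]],
        [seq m i | i : 'I_5] = [:: 1; 1; a; a; n]%N
      & forall i, FS_indicator (schemeD A1 A2) (chi i) (m i) = 1].
Proof.
have [kappa [aE rowsum colsum sqA]] := scheme_params hA2 hA.
have a_gt0 := scheme_gt0 hA; have sumA := scheme_sum hA.
exists (@D_char _ a), (D_mult a); split.
- exact: (D_enumerates a_gt0 aE hA2 sumA rowsum colsum sqA).
- exact: (D_mult_ok a_gt0 aE hA2 rowsum colsum (scheme_skew hA2 hA)).
- exact: (D_table a_gt0 aE hA2 rowsum colsum).
- by rewrite hn /image_mem !enum_ordSl enum_ord0.
move=> i; exact: (D_FS a_gt0 aE hA2 rowsum colsum (scheme_01 hA) (scheme_skew hA2 hA)).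
Qed.
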